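(* Let $N=\{1,\ldots,n\}$, $\boldsymbol\beta\in\mathbb{R}^n_+$, let $L_1,\ldots,L_{k_l}$ be pairwise disjoint subsets of $N$ with union $N$ and $l_1,\ldots,l_{k_l}\in\mathbb Z_+$ with $\sum_k l_k\le n$, let $F_1,\ldots,F_{k_f}$ be pairwise disjoint subsets of $N$ with union $N$ and $f_1,\ldots,f_{k_f}\in\mathbb Z_+$ with $\sum_k f_k\le n$, and let $\mathcal{I}_X=\{\mathbf{x}\in\{0,1\}^n:\ \sum_{i\in L_{k'}}x_i\le l_{k'}\ \forall k'\}$ and $\mathcal{I}_Y(\mathbf{x})=\{\mathbf{y}\in\{0,1\}^n:\ \mathbf{y}\le\mathbf{1}-\mathbf{x},\ \sum_{i\in F_k}y_i\le f_k\ \forall k\}$. Then the dynamic programming algorithm described below computes an optimal solution $\mathbf x^*\in\mathcal I_X$ and the optimal value of $\min_{\mathbf x\in\mathcal I_X}\max_{\mathbf y\in\mathcal I_Y(\mathbf x)}\boldsymbol\beta^\top\mathbf y$ using $O(n^{2k_l+1})$ arithmetic operations and $O(n^{k_l+1})$ space.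
   Context: For $k\in\{1,\ldots,k_f\}$ write $\mathbf x^{(k)}$ for the restriction of $\mathbf x$ to the indices in $F_k$, and $\psi_k(\mathbf x^{(k)})=\max\{\sum_{i\in F_k}\beta_iy_i:\ 0\le y_i\le 1-x_i\ (i\in F_k),\ \sum_{i\in F_k}y_i\le f_k\}$, so that the objective equals $\sum_k\psi_k(\mathbf x^{(k)})$. States: $R_1=\{(l_1,\ldots,l_{k_l})\}$ and, for $k\ge 2$, $R_k=\{\mathbf r\in\mathbb Z_+^{k_l}: r_{k'}\le l_{k'}\ \forall k'\}$ (residual leader budgets). Actions at stage $k$ in state $\mathbf r_k$: $A^{(k)}(\mathbf r_k)=\{\mathbf x^{(k)}\in\{0,1\}^{F_k}:\ \sum_{i\in F_k\cap L_{k'}}x_i\le r_{k,k'}\ \forall k'\}$. Transition: $\boldsymbol\theta_k(\mathbf r_k,\mathbf x^{(k)})=(r_{k,k'}-\sum_{i\in F_k\cap L_{k'}}x_i)_{k'}$. The algorithm (Algorithm 1) computes, backward, $V_{k_f}(\mathbf r)=\min_{\mathbf x^{(k_f)}\in A^{(k_f)}(\mathbf r)}\psi_{k_f}(\mathbf x^{(k_f)})$ and, for $k=k_f-1,\ldots,1$, $V_k(\mathbf r)=\min_{\mathbf x^{(k)}\in A^{(k)}(\mathbf r)}\{\psi_k(\mathbf x^{(k)})+V_{k+1}(\boldsymbol\theta_k(\mathbf r,\mathbf x^{(k)}))\}$ for all states $\mathbf r\in R_k$, storing a minimizer $\tilde{\mathbf x}^{*(k)}(\mathbf r)$; it then sets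 $\mathbf r_1^*=(l_{k'})_{k'}$, $\mathbf x^{*(1)}=\tilde{\mathbf x}^{*(1)}(\mathbf r_1^* )$, and for $k=2,\ldots,k_f$, $\mathbf r_k^*=\boldsymbol\theta_{k-1}(\mathbf r_{k-1}^*,\mathbf x^{*(k-1)})$, $\mathbf x^{*(k)}=\tilde{\mathbf x}^{*(k)}(\mathbf r_k^* )$, and returns $\mathbf x^*$ and $V_1(\mathbf r_1^* )$.
   Formalization: The operation and space bounds are proved assuming k_f ≤ n (automatic when all F_k are nonempty); with arbitrarily many empty F_k they fail, since the algorithm fills k_f tables. The O-constants may depend on k_l, and n ≥ 1. *)

(* Defs.v *)
(* MathComp / MathComp-Analysis *)
From HB Require Import structures.
From mathcomp Require Import all_boot all_order all_algebra.
From mathcomp Require Import boolp classical_sets reals.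

Set Implicit Arguments.
Unset Strict Implicit.
Unset Printing Implicit Defensive.

Import Order.TTheory GRing.Theory Num.Theory.
Local Open Scope ring_scope.

(** * The interdiction problem *)

(* Blocks may be empty. *)
Record instance (R : realType) (n kl kf : nat) := Instance {
  beta : 'I_n -> R;
  beta_ge0 : forall i, 0 <= beta i;
  L : 'I_kl -> {set 'I_n};
  L_disjoint : forall j1 j2, j1 != j2 -> [disjoint L j1 & L j2];
  L_cover : \bigcup_j L j = [set: 'I_n];
  l : 'I_kl -> nat;
  l_sum : (\sum_j l j <= n)%N;
  F : 'I_kf -> {set 'I_n};
  F_disjoint : forall k1 k2, k1 != k2 -> [disjoint F k1 & F k2];
  F_cover : \bigcup_k F k = [set: 'I_n];
  f : 'I_kf -> nat;
  f_sum : (\sum_k f k <= n)%N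
}.

(* Greatest / least element of a set of reals (a junk value if the extremum is
   not attained). *)
Definition maximum (R : realType) (A : set R) : R :=
  xget 0 (fun v => A v /\ forall w, A w -> w <= v).
Definition minimum (R : realType) (A : set R) : R :=
  xget 0 (fun v => A v /\ forall w, A w -> v <= w).

(* Vectors of {0,1}^n; booleans are coerced to 0 and 1. *)
Notation bvec n := {ffun 'I_n -> bool}.

Section Problem.
Context {R : realType} {n kl kf : nat} (I : instance R n kl kf).

Definition in_IX (x : bvec n) : Prop :=
  forall j : 'I_kl, (\sum_(i in L I j) x i <= l I j)%N.

Definition in_IY (x y : bvec n) : Prop :=
  (forall i, (y i <= 1 - x i)%N) /\
  (forall k : 'I_kf, (\sum_(i in F I k) y i <= f I k)%N).

Definition follower_value (x : bvec n) : R :=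
  maximum (fun v => exists2 y, in_IY x y & v = \sum_i beta I i * (y i)%:R).

Definition optimal_value : R :=
  minimum (fun v => exists2 x, in_IX x & v = follower_value x).

Definition optimal_solution (x : bvec n) : Prop :=
  in_IX x /\ follower_value x = optimal_value.

(** * The dynamic program

   Stages are numbered from 0.  A stage vector x^(k) in {0,1}^(F_k) is a
   vector of {0,1}^n that vanishes outside F_k. *)

Notation state := {ffun 'I_kl -> nat}.

Definition psi (k : 'I_kf) (x : bvec n) : R :=
  maximum (fun v => exists y : 'I_n -> R,
    [/\ forall i, i \in F I k -> 0 <= y i <= 1 - (x i)%:R,
        \sum_(i in F I k) y i <= (f I k)%:R
      & v = \sum_(i in F I k) beta I i * y i]).

Definition full_budget : state := [ffun j => l I j].

Definition stage_state (k : 'I_kf) (r : state) : Prop :=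
  if k == 0%N :> nat then r = full_budget else forall j, (r j <= l I j)%N.

Definition stage_action (k : 'I_kf) (r : state) (x : bvec n) : Prop :=
  (forall i, x i -> i \in F I k) /\
  (forall j, (\sum_(i in F I k :&: L I j) x i <= r j)%N).

Definition theta (k : 'I_kf) (r : state) (x : bvec n) : state :=
  [ffun j => (r j - \sum_(i in F I k :&: L I j) x i)%N].

(* psi_k(x) + V_{k+1}(theta_k(r, x)), without the second term at the last
   stage. *)
Definition cost_to_go (V : 'I_kf -> state -> R) k r x : R :=
  psi k x + oapp (fun k' : 'I_kf => V k' (theta k r x)) 0 (insub k.+1).

(* [V] is the table of values and [xt] the table of stored minimizers; ties may
   be broken arbitrarily. *)
Definition backward_pass (V : 'I_kf -> state -> R) (xt : 'I_kf -> state -> bvec n)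
    : Prop :=
  forall k r, stage_state k r ->
    [/\ stage_action k r (xt k r),
        V k r = cost_to_go V k r (xt k r)
      & forall x, stage_action k r x -> V k r <= cost_to_go V k r x].

Definition forward_pass (xt : 'I_kf -> state -> bvec n) (rs : 'I_kf -> state)
    (x : bvec n) : Prop :=
  [/\ forall k : 'I_kf, k = 0%N :> nat -> rs k = full_budget,
      forall k k' : 'I_kf, k' = k.+1 :> nat ->
        rs k' = theta k (rs k) (xt k (rs k))
    & forall (k : 'I_kf) i, i \in F I k -> x i = xt k (rs k) i].

(* A run of the algorithm with tables [V], [xt], returning [x] and [v]. *)
Definition dp_run (V : 'I_kf -> state -> R) (xt : 'I_kf -> state -> bvec n)
    (x : bvec n) (v : R) : Prop :=
  [/\ backward_pass V xt,
      exists rs, forward_pass xt rs x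
    & exists2 k : 'I_kf, k = 0%N :> nat & v = V k full_budget].

End Problem.

(** * A real RAM

   Arithmetic operations and space are counted on a random access machine with
   integer arrays and real arrays.  A program is a fixed finite text (it
   mentions finitely many arrays); real numbers can only be copied, added,
   subtracted and compared. *)

Inductive iop := IAdd | ISub | IMul | IDiv | IMod.

Inductive iexp :=
| ILit of nat
| IGet of nat & iexp           (* [IGet a e]: entry e of the integer array a *)
| IBin of iop & iexp & iexp.

Inductive rexp :=
| RZero
| RGet of nat & iexp           (* [RGet a e]: entry e of the real array a *)
| RAdd of rexp & rexp
| RSub of rexp & rexp.

Inductive bexp :=
| BLeI of iexp & iexp
| BLeR of rexp & rexp
| BNot of bexp
| BAnd of bexp & bexp.

Inductive cmd :=
| Skip
| ISet of nat & iexp & iexp    (* [ISet a e1 e2]: store e2 at entry e1 of a *)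
| RSet of nat & iexp & rexp
| Seq of cmd & cmd
| If of bexp & cmd & cmd
| While of bexp & cmd.

Record memory (R : realType) := Memory {
  ints : nat -> nat -> nat;
  reals : nat -> nat -> R
}.

Definition update (T : Type) (h : nat -> nat -> T) (a p : nat) (v : T) :=
  fun a' p' : nat => if (a' == a) && (p' == p) then v else h a' p'.

Section Machine.
Context {R : realType}.
Implicit Type m : memory R.

Definition iop_eval (o : iop) (u v : nat) : nat :=
  match o with
  | IAdd => u + v | ISub => u - v | IMul => u * v | IDiv => u %/ v | IMod => u %% v
  end.

Fixpoint ieval m (e : iexp) : nat :=
  match e with
  | ILit c => c
  | IGet a e => ints m a (ieval m e)
  | IBin o e1 e2 => iop_eval o (ieval m e1) (ieval m e2)
  end.

Fixpoint reval m (e : rexp) : R :=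
  match e with
  | RZero => 0
  | RGet a e => reals m a (ieval m e)
  | RAdd e1 e2 => reval m e1 + reval m e2
  | RSub e1 e2 => reval m e1 - reval m e2
  end.

Fixpoint beval m (b : bexp) : bool :=
  match b with
  | BLeI e1 e2 => (ieval m e1 <= ieval m e2)%N
  | BLeR e1 e2 => reval m e1 <= reval m e2
  | BNot b => ~~ beval m b
  | BAnd b1 b2 => beval m b1 && beval m b2
  end.

(* [iok w m e]: every integer met when evaluating e, hence every address, is
   smaller than w. *)
Fixpoint iok (w : nat) m (e : iexp) : bool :=
  (ieval m e < w)%N &&
  match e with
  | ILit _ => true
  | IGet _ e => iok w m e
  | IBin _ e1 e2 => iok w m e1 && iok w m e2
  end.

Fixpoint rok (w : nat) m (e : rexp) : bool :=
  match e with
  | RZero => true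
  | RGet _ e => iok w m e
  | RAdd e1 e2 | RSub e1 e2 => rok w m e1 && rok w m e2
  end.

Fixpoint bok (w : nat) m (b : bexp) : bool :=
  match b with
  | BLeI e1 e2 => iok w m e1 && iok w m e2
  | BLeR e1 e2 => rok w m e1 && rok w m e2
  | BNot b => bok w m b
  | BAnd b1 b2 => bok w m b1 && bok w m b2
  end.

Fixpoint icost (e : iexp) : nat :=
  match e with
  | ILit _ => 1
  | IGet _ e => (icost e).+1
  | IBin _ e1 e2 => (icost e1 + icost e2).+1
  end.

Fixpoint rcost (e : rexp) : nat :=
  match e with
  | RZero => 1
  | RGet _ e => (icost e).+1
  | RAdd e1 e2 | RSub e1 e2 => (rcost e1 + rcost e2).+1
  end.

Fixpoint bcost (b : bexp) : nat :=
  match b with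
  | BLeI e1 e2 => (icost e1 + icost e2).+1
  | BLeR e1 e2 => (rcost e1 + rcost e2).+1
  | BNot b => (bcost b).+1
  | BAnd b1 b2 => (bcost b1 + bcost b2).+1
  end.

(* [exec w c m m' t]: started in m, the command c terminates in m' after t
   operations (memory accesses, comparisons and integer operations included),
   in space w: only entries 0, ..., w-1 of each array are accessed and integers
   stay below w (otherwise the execution is stuck). *)
Inductive exec (w : nat) : cmd -> memory R -> memory R -> nat -> Prop :=
| exec_skip m : exec w Skip m m 1
| exec_iset m a e1 e2 : iok w m e1 -> iok w m e2 ->
    exec w (ISet a e1 e2) m
      (Memory (update (ints m) a (ieval m e1) (ieval m e2)) (reals m))
      (icost e1 + icost e2).+1
| exec_rset m a e1 e2 : iok w m e1 -> rok w m e2 ->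
    exec w (RSet a e1 e2) m
      (Memory (ints m) (update (reals m) a (ieval m e1) (reval m e2)))
      (icost e1 + rcost e2).+1
| exec_seq m1 m2 m3 c1 c2 t1 t2 :
    exec w c1 m1 m2 t1 -> exec w c2 m2 m3 t2 ->
    exec w (Seq c1 c2) m1 m3 (t1 + t2)
| exec_if m m' b c1 c2 t : bok w m b ->
    exec w (if beval m b then c1 else c2) m m' t ->
    exec w (If b c1 c2) m m' (bcost b + t).+1
| exec_while_end m b c : bok w m b -> ~~ beval m b ->
    exec w (While b c) m m (bcost b).+1
| exec_while_step m1 m2 m3 b c t1 t2 : bok w m1 b -> beval m1 b ->
    exec w c m1 m2 t1 -> exec w (While b c) m2 m3 t2 ->
    exec w (While b c) m1 m3 (bcost b + t1 + t2).+1.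

End Machine.

(** * Input and output conventions *)

Section Layout.
Context {R : realType} {n kl kf : nat} (I : instance R n kl kf).

(* Input.  Integer array 0: n, kl, kf; arrays 1 and 2: for each element, the
   index of its block among the L's and among the F's; arrays 3 and 4: l and f.
   Real array 0: beta.  Everything else is arbitrary. *)
Definition input_memory (m : memory R) : Prop :=
  [/\ [/\ ints m 0 0 = n, ints m 0 1 = kl & ints m 0 2 = kf],
      forall (i : 'I_n) (j : 'I_kl), i \in L I j -> ints m 1 i = j,
      forall (i : 'I_n) (k : 'I_kf), i \in F I k -> ints m 2 i = k,
      (forall j : 'I_kl, ints m 3 j = l I j) /\
      (forall k : 'I_kf, ints m 4 k = f I k)
    & forall i : 'I_n, reals m 0 i = beta I i].

(* Mixed radix code of a vector of residual budgets. *)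
Definition state_count : nat := \prod_j (l I j).+1.
Definition state_code (r : {ffun 'I_kl -> nat}) : nat :=
  \sum_j r j * \prod_(j' : 'I_kl | (j' < j)%N) (l I j').+1.

(* Output.  Integer array 5: x; real array 1: v; real array 2: the table V;
   integer array 6: the table xt. *)
Definition output_memory (V : 'I_kf -> {ffun 'I_kl -> nat} -> R)
    (xt : 'I_kf -> {ffun 'I_kl -> nat} -> bvec n) (x : bvec n) (v : R)
    (m : memory R) : Prop :=
  [/\ forall i : 'I_n, ints m 5 i = x i,
      reals m 1 0 = v,
      forall k r, stage_state I k r ->
        reals m 2 (k * state_count + state_code r)%N = V k r
    & forall k r (i : 'I_n), stage_state I k r -> i \in F I k ->
        ints m 6 (state_code r * n + i)%N = xt k r i].

End Layout.

(* Main.v *)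
Require Import Defs.
From mathcomp Require Import all_boot all_order all_algebra.
From mathcomp Require Import boolp classical_sets reals.
From mathcomp Require Import zify lra.
From mathcomp Require Import fintype finset.

(* By LP duality the follower's best reply in one block F_k is greedy, and for
   given numbers u_j of interdicted elements in the sets F_k :&: L_j it is best
   for the leader to interdict the u_j elements of largest beta in each of them.
   Hence a stage of the dynamic program only has to enumerate, for every state r,
   the vectors u <= r: there are O(n^kl) of either kind, and O(n^(2 kl)) pairs.
   With block_rank i j the number of elements of F_k :&: L_j preceding i, an
   element i of F_k :&: L_j is interdicted iff block_rank i j < u_j, and
   otherwise taken by the follower iff \sum_j (block_rank i j - u_j) < f_k; so
   the greedy choices need no sorting, only a table of ranks. *)

Set Implicit Arguments.
Unset Strict Implicit.
Unset Printing Implicit Defensive.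

Import Order.TTheory GRing.Theory Num.Theory.
Local Open Scope ring_scope.

(** The exponent of the time bound comes from the order of the loops. The counts u are enumerated
    outside the states r, so that the follower's value for u, an O(n) computation, is paid once per
    u and not once per pair; a stage then costs n^kl (n + n^kl), and there are kf <= n stages.
    Within a stage the minimizers are kept as codes of count vectors; they are expanded into bits
    only at its end. The inner step has constant cost for fixed kl because states and counts are
    mixed radix integers and, for a feasible action, the transition is a subtraction of codes. The
    bits of all stages share one table of S n cells, S being the number of states, since each item
    belongs to a single stage; together with kf + 1 rows of values this gives the space bound.
    Restricting to greedy actions is compatible with the recursion because the exchange preserves
    the counts and hence the next state. That a run of the algorithm exists is read off from the
    verified program itself. *)

Lemma maximum_eq (R : realType) (A : set R) v :
  A v -> (forall w, A w -> w <= v) -> maximum A = v.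
Proof.
move=> Av ub; rewrite /maximum; case: xgetP => [w _ [Aw ubw]|/(_ v)[]//].
by apply/le_anti; rewrite ub ?ubw.
Qed.

Lemma minimum_eq (R : realType) (A : set R) v :
  A v -> (forall w, A w -> v <= w) -> minimum A = v.
Proof.
move=> Av lb; rewrite /minimum; case: xgetP => [w _ [Aw lbw]|/(_ v)[]//].
by apply/le_anti; rewrite lb ?lbw.
Qed.

(** * Selecting the largest elements *)

Section Selection.
Variables (R : realType) (n : nat) (b : 'I_n -> R).
Implicit Types (A : {set 'I_n}) (i : 'I_n) (m : nat) (g z : 'I_n -> R).

(** Decreasing [b], ties broken by index, so that ranks are distinct. Only [<=] occurs, as in the
    tests of the machine. *)
Definition prec i' i := (b i <= b i') && ~~ ((b i' <= b i) && (i <= i')%N).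

Lemma prec_irr i : prec i i = false.
Proof. by rewrite /prec lexx leqnn. Qed.

Lemma prec_trans : transitive prec.
Proof.
move=> y x z /andP[xy nxy] /andP[yz nyz]; rewrite /prec (le_trans yz xy) /=.
apply/negP => /andP[xz zx]; move: nxy nyz.
have -> : b x <= b y by exact: le_trans xz yz.
have -> : b y <= b z by exact: le_trans xy xz.
by rewrite /= -!ltnNge => xy' yz'; move: (ltn_trans xy' yz'); rewrite ltnNge zx.
Qed.

Lemma prec_total i i' : i != i' -> prec i i' || prec i' i.
Proof.
move=> ne; rewrite /prec; have {ne} : (i < i')%N || (i' < i)%N by rewrite -neq_ltn.
case: (ltgtP (b i) (b i')) => //= _; rewrite -!ltnNge //.
Qed.

Lemma prec_le i i' : prec i i' -> b i' <= b i.
Proof. by case/andP. Qed.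

Definition rank A i := #|[set i' in A | prec i' i]|.

Definition top m A := [set i in A | (rank A i < m)%N].

Lemma rank_lt A i i' : i \in A -> prec i i' -> (rank A i < rank A i')%N.
Proof.
move=> Ai pii'; apply/proper_card/properP; split.
  apply/subsetP => j; rewrite !inE => /andP[-> pji] /=; exact: prec_trans pji pii'.
by exists i; rewrite !inE ?Ai ?pii' // prec_irr andbF.
Qed.

Lemma top_sub m A : top m A \subset A.
Proof. by apply/subsetP => i; rewrite inE => /andP[]. Qed.

(** Take the selected element of largest rank: the other selected ones all precede it, and its rank
    is below [m]. *)
Lemma card_top_le m A : (#|top m A| <= m)%N.
Proof.
have [-> | [i0 i0T]] := set_0Vmem (top m A); first by rewrite cards0.
case: (arg_maxnP (P := [in top m A]) (rank A) i0T) => i1 /= i1T imax.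
have /andP[Ai1] : (i1 \in A) && (rank A i1 < m)%N by move: i1T; rewrite /= inE.
apply: leq_trans.
have sub : top m A \subset i1 |: [set i in A | prec i i1].
  apply/subsetP => i iT; rewrite !inE; case: eqVneq => //= ne.
  move: (iT); rewrite inE => /andP[Ai _]; rewrite Ai /=.
  case/orP: (prec_total ne) => // /(rank_lt Ai1).
  by rewrite ltnNge (imax i iT).
apply: leq_trans (subset_leq_card sub) _.
by rewrite cardsU1 !inE prec_irr andbF.
Qed.

(** The element of least rank outside [top m A] is the threshold between taken and left out; its
    value becomes the dual multiplier. *)
Lemma first_left_out m A i : i \in A -> i \notin top m A ->
  exists i0, [/\ i0 \in A, #|top m A| = m,
    forall i', i' \in top m A -> prec i' i0 &
    forall i', i' \in A -> i' \notin top m A -> i' != i0 -> prec i0 i'].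
Proof.
move=> Ai iT; have iD : i \in A :\: top m A by rewrite inE iT.
case: (arg_minnP (P := [in A :\: top m A]) (rank A) iD) => i0 /=.
rewrite inE => /andP[i0T Ai0] imin.
have mi0 : (m <= rank A i0)%N by move: i0T; rewrite inE Ai0 /= -leqNgt.
exists i0; split=> //.
- apply/eqP; rewrite eqn_leq card_top_le; apply: leq_trans mi0 _.
  apply/subset_leq_card/subsetP => j; rewrite !inE => /andP[Aj pj].
  rewrite Aj /= ltnNge; apply/negP => mj.
  have jD : j \in A :\: top m A by rewrite !inE Aj /= -leqNgt mj.
  by have := imin _ jD; rewrite leqNgt (rank_lt Aj pj).
- move=> j jT; have ne : j != i0 by apply: contraNneq i0T => <-.
  case/orP: (prec_total ne) => // /(rank_lt Ai0).
  by rewrite ltnNge => /negP[]; move: jT; rewrite inE => /andP[_ /ltnW/leq_trans->].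
- move=> j Aj jT ne; case/orP: (prec_total ne) => // /(rank_lt Aj).
  by rewrite ltnNge imin // inE jT.
Qed.

Lemma card_top m A : #|top m A| = minn m #|A|.
Proof.
have [sA | ] := boolP (A \subset top m A).
  have eA : top m A = A by apply/eqP; rewrite eqEsubset top_sub.
  by rewrite eA; have := card_top_le m A; rewrite eA => /minn_idPr.
case/subsetPn => i Ai /(first_left_out Ai)[i0 [_ cT _ _]].
by rewrite cT; apply/esym/minn_idPl; rewrite -cT subset_leq_card ?top_sub.
Qed.

(** Optimal dual variables of the bounds z_i <= 1, summed, once the cardinality constraint has
    multiplier [s]: the dual objective is s m + [excess g A s]. *)
Definition excess g A s := \sum_(i in A) Num.max (g i - s) 0.

(** Weak duality, from g z = s z + (g - s) z <= s z + (g - s)^+ for z in [0,1]. *)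
Lemma knapsack_le g m A z s : 0 <= s ->
  (forall i, i \in A -> 0 <= z i <= 1) -> \sum_(i in A) z i <= m%:R ->
  \sum_(i in A) g i * z i <= s * m%:R + excess g A s.
Proof.
move=> s0 z01 zm; apply: le_trans (_ : _ <= s * \sum_(i in A) z i + excess g A s) _.
  rewrite mulr_sumr -big_split /=; apply: ler_sum => i /z01/andP[z0 z1].
  have : (g i - s) * z i <= Num.max (g i - s) 0.
    have [ge0|lt0] := leP 0 (g i - s).
      by rewrite -[leRHS]mulr1 ler_wpM2l.
    by rewrite mulr_le0_ge0 // ltW.
  lra.
by rewrite lerD2r ler_wpM2l.
Qed.

(** Strong duality by complementary slackness: [s] is 0 if everything fits, and otherwise the value
    of the first element left out. The weights [g] are only monotone along [prec], because the
    exchange argument uses the truncated weights (beta - s)^+ with the order of beta. *)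
Lemma top_excess g m A : (forall i, 0 <= g i) ->
    (forall i i', prec i i' -> g i' <= g i) ->
  exists2 s, 0 <= s & \sum_(i in top m A) g i = s * m%:R + excess g A s.
Proof.
move=> g0 gp; have [sA | ] := boolP (A \subset top m A).
  exists 0 => //; have -> : top m A = A by apply/eqP; rewrite eqEsubset top_sub.
  by rewrite mul0r add0r; apply: eq_bigr => i _; rewrite subr0 max_l.
case/subsetPn => i Ai /(first_left_out Ai)[i0 [_ cT pT pA]].
exists (g i0) => //; rewrite /excess [in RHS](bigID (mem (top m A))) /=.
rewrite [X in _ + (_ + X)]big1 ?addr0; last first.
  move=> j /andP[Aj jT]; apply/max_r; rewrite subr_le0.
  by have [->//|ne] := eqVneq j i0; apply/gp/pA.
rewrite -[X in _ * X%:R]cT -sumr_const mulr_sumr.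
rewrite [X in _ + X](eq_bigl (fun j => j \in top m A)); last first.
  by move=> j /=; rewrite !inE; case: (j \in A).
rewrite -big_split /=; apply: eq_bigr => j /pT/gp gj.
by rewrite max_l ?subr_ge0 // mulr1 addrC subrK.
Qed.

Lemma top_max g m A z : (forall i, 0 <= g i) ->
    (forall i i', prec i i' -> g i' <= g i) ->
    (forall i, i \in A -> 0 <= z i <= 1) -> \sum_(i in A) z i <= m%:R ->
  \sum_(i in A) g i * z i <= \sum_(i in top m A) g i.
Proof.
move=> g0 gp z01 zm; have [s s0 ->] := top_excess m A g0 gp.
exact: knapsack_le.
Qed.

End Selection.

(** * The two partitions of the items and the follower's value *)

Section Stages.
Context {R : realType} {n kl kf : nat} (I : instance R n kl kf).
Implicit Types (x y : bvec n) (i : 'I_n) (j : 'I_kl) (k : 'I_kf).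
Local Notation state := {ffun 'I_kl -> nat}.
Implicit Types r u : state.

Lemma ex_lidx i : exists j, i \in L I j.
Proof.
have : i \in \bigcup_j L I j by rewrite L_cover inE.
by case/bigcupP => j _ ij; exists j.
Qed.

Lemma ex_fidx i : exists k, i \in F I k.
Proof.
have : i \in \bigcup_k F I k by rewrite F_cover inE.
by case/bigcupP => k _ ik; exists k.
Qed.

Definition lidx i := xchoose (ex_lidx i).
Definition fidx i := xchoose (ex_fidx i).

Lemma in_L i j : (i \in L I j) = (lidx i == j).
Proof.
have il : i \in L I (lidx i) by exact: (xchooseP (ex_lidx i)).
apply/idP/eqP => [ij|<-//]; apply: contraTeq ij => ne.
by rewrite (disjointFr (L_disjoint I ne) il).
Qed.

Lemma in_F i k : (i \in F I k) = (fidx i == k).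
Proof.
have il : i \in F I (fidx i) by exact: (xchooseP (ex_fidx i)).
apply/idP/eqP => [ij|<-//]; apply: contraTeq ij => ne.
by rewrite (disjointFr (F_disjoint I ne) il).
Qed.

Lemma sum_blocks (T : nmodType) (A : {set 'I_n}) (g : 'I_n -> T) :
  \sum_(i in A) g i = \sum_j \sum_(i in A :&: L I j) g i.
Proof.
rewrite (partition_big lidx predT) //=; apply: eq_bigr => j _.
by apply: eq_bigl => i; rewrite inE in_L.
Qed.

Lemma sum_stages (T : nmodType) (g : 'I_n -> T) :
  \sum_i g i = \sum_k \sum_(i in F I k) g i.
Proof.
rewrite (partition_big fidx predT) //=; apply: eq_bigr => k _.
by apply: eq_bigl => i; rewrite in_F.
Qed.

(** * The follower's problem in one block *)

Definition avail k x := [set i in F I k | ~~ x i].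

(** The maximum defining [psi] is over real y, yet it is attained at the indicator of the greedy
    set. For the upper bound, y vanishes on interdicted items, and [top_max] applies to the free
    ones. *)
Lemma psi_top k x :
  psi I k x = \sum_(i in top (beta I) (f I k) (avail k x)) beta I i.
Proof.
set A := avail k x; set T := top _ _ A.
have TF i : i \in T -> i \in F I k by rewrite !inE => /andP[/andP[]].
apply: maximum_eq.
  exists (fun i => (i \in T)%:R); split.
  - move=> i _; rewrite ler0n /=; case: (boolP (i \in T)); last first.
      by rewrite subr_ge0 lern1 leq_b1.
    by rewrite !inE => /andP[/andP[_ /negbTE->] _]; rewrite subr0.
  - rewrite -natr_sum ler_nat -big_mkcondr /= sum1_card.
    apply: leq_trans (card_top_le (beta I) (f I k) A); apply/subset_leq_card/fintype.subsetP => i.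
    by rewrite unfold_in => /andP[].
  rewrite [LHS](eq_bigl (fun i => (i \in F I k) && (i \in T))); last first.
    by move=> i; apply/idP/andP => [iT|[]//]; rewrite TF.
  by rewrite big_mkcondr; apply: eq_bigr => i _; case: (i \in T); rewrite ?mulr1 ?mulr0.
move=> _ [y [y01 ysum ->]].
have split_free (g : 'I_n -> R) :
    \sum_(i in F I k) g i = \sum_(i in A) g i + \sum_(i in F I k | x i) g i.
  rewrite (bigID x) addrC /=; congr +%R; apply: eq_bigl => i.
  by rewrite inE.
rewrite split_free [X in _ + X]big1 ?addr0; last first.
  move=> i /andP[/y01 + xi]; rewrite xi subrr -eq_le => /eqP <-.
  by rewrite mulr0.
apply: top_max.
- exact: beta_ge0.
- by move=> i i'; exact: prec_le.
- by move=> i; rewrite inE => /andP[/y01 yi /negbTE xi]; move: yi; rewrite xi subr0.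
apply: le_trans ysum; rewrite split_free lerDl; apply: sumr_ge0 => i /andP[/y01].
by case/andP.
Qed.

(** Weak duality at the greedy 0/1 vector, for every multiplier; [psi_excess] supplies a multiplier
    with equality. *)
Lemma psi_le_excess k x s : 0 <= s ->
  psi I k x <= s * (f I k)%:R + excess (beta I) (avail k x) s.
Proof.
move=> s0; rewrite psi_top; set T := top _ _ _.
have sT := fintype.subsetP (top_sub (beta I) (f I k) (avail k x)).
rewrite [leLHS](_ : _ = \sum_(i in avail k x) beta I i * (i \in T)%:R).
  apply: knapsack_le => // [i _|]; first by case: (i \in T); rewrite ler01 lexx.
  rewrite -natr_sum ler_nat -big_mkcondr /= sum1_card.
  apply: leq_trans (card_top_le (beta I) (f I k) (avail k x)).
  by apply/subset_leq_card/fintype.subsetP => i; rewrite unfold_in => /andP[].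
rewrite [LHS](eq_bigl (fun i => (i \in avail k x) && (i \in T))); last first.
  by move=> i; apply/idP/andP => [iT|[]//]; rewrite sT.
by rewrite big_mkcondr; apply: eq_bigr => i _; case: (i \in T); rewrite ?mulr1 ?mulr0.
Qed.

Lemma psi_excess k x : exists2 s, 0 <= s &
  psi I k x = s * (f I k)%:R + excess (beta I) (avail k x) s.
Proof.
rewrite psi_top; apply: top_excess; first exact: beta_ge0.
by move=> i i'; exact: prec_le.
Qed.

(** The sets F_k partition the items, so the greedy sets of the blocks glue to one binary reply. It
    is optimal for the binary problem and for each fractional [psi], hence there is no integrality
    gap. *)
Lemma follower_psi x : follower_value I x = \sum_k psi I k x.
Proof.
pose y : bvec n := [ffun i => i \in top (beta I) (f I (fidx i)) (avail (fidx i) x)].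
have yE k : (fun i => (i \in F I k) && y i) =1
    (mem (top (beta I) (f I k) (avail k x))).
  move=> i; rewrite ffunE /=; have [ik|/negP ik] := boolP (i \in F I k).
    by move: (ik); rewrite in_F => /eqP->.
  by apply/esym/negbTE/negP; rewrite !inE => /andP[/andP[]].
apply: maximum_eq.
  exists y; first split.
  - move=> i; rewrite ffunE; case: (boolP (i \in _)) => //; rewrite !inE.
    by case: (x i); rewrite ?andbF.
  - move=> k; rewrite -big_mkcondr /= sum1_card (eq_card (yE k)).
    exact: card_top_le.
  rewrite sum_stages; apply: eq_bigr => k _; rewrite psi_top.
  rewrite -[LHS](eq_bigl _ _ (yE k)) big_mkcondr; apply: eq_bigr => i _.
  by case: (y i); rewrite ?mulr1 ?mulr0.
move=> _ [y' [y'x y'f] ->]; rewrite sum_stages; apply: ler_sum => k _.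
rewrite psi_top; set A := avail k x.
rewrite (bigID x) /= [X in X + _]big1 ?add0r; last first.
  by move=> i /andP[_ xi]; have := y'x i; rewrite xi leqn0 eqb0 => /negbTE->; rewrite mulr0.
rewrite (eq_bigl (mem A)); last by move=> i; rewrite !inE.
apply: top_max.
- exact: beta_ge0.
- by move=> i i'; exact: prec_le.
- by move=> i _; rewrite ler0n lern1 leq_b1.
rewrite -natr_sum ler_nat; apply: leq_trans (y'f k).
rewrite [leqRHS](bigID x) /= -[leqLHS]add0n leq_add //.
by rewrite [leqRHS](eq_bigl (mem A)) // => i; rewrite !inE.
Qed.

End Stages.

(** * Big operators over initial segments, the form taken by loop invariants *)

Section PrefixSums.
Variables (T : Type) (idx : T) (op : Monoid.com_law idx) (n : nat) (G : 'I_n -> T).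

Lemma big_ord_ltS (q : 'I_n) :
  \big[op/idx]_(i < n | (i < q.+1)%N) G i =
  op (\big[op/idx]_(i < n | (i < q)%N) G i) (G q).
Proof.
rewrite (bigD1 q) //= Monoid.mulmC; congr (op _ _); apply: eq_bigl => i.
by rewrite ltnS ltn_neqAle andbC.
Qed.

Lemma big_ord_lt0 : \big[op/idx]_(i < n | (i < 0)%N) G i = idx.
Proof. exact: big_pred0. Qed.

Lemma big_ord_ltn : \big[op/idx]_(i < n | (i < n)%N) G i = \big[op/idx]_(i < n) G i.
Proof. by apply: eq_bigl => i; rewrite ltn_ord. Qed.

End PrefixSums.

(** * Interdiction counts, greedy actions and the exchange argument *)

Section Exchange.
Context {R : realType} {n kl kf : nat} (I : instance R n kl kf).
Implicit Types (x y : bvec n) (i : 'I_n) (j : 'I_kl) (k : 'I_kf).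
Local Notation state := {ffun 'I_kl -> nat}.
Implicit Types r u : state.

Definition usage k x : state := [ffun j => \sum_(i in F I k :&: L I j) x i]%N.

Definition block_rank i j := rank (beta I) (F I (fidx I i) :&: L I j) i.

Definition greedy k u : bvec n :=
  [ffun i => (i \in F I k) && (block_rank i (lidx I i) < u (lidx I i))%N].

Lemma greedy_top k u j i : i \in F I k :&: L I j ->
  greedy k u i = (i \in top (beta I) (u j) (F I k :&: L I j)).
Proof.
rewrite ffunE [in RHS]inE /block_rank => ikj; rewrite ikj.
by move: ikj; rewrite !inE in_F in_L => /andP[/eqP-> /eqP->]; rewrite eqxx.
Qed.

(** A count may exceed the size of its block, so the budget actually spent is capped. This is why
    the program subtracts the code of the usage and not that of [u]. *)
Lemma usage_greedy k u j : usage k (greedy k u) j = minn (u j) #|F I k :&: L I j|.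
Proof.
rewrite ffunE -(card_top (beta I)) -sum1_card.
rewrite (eq_bigr (fun i => (i \in top (beta I) (u j) (F I k :&: L I j)) : nat)).
  rewrite -big_mkcondr /=; apply: eq_bigl => i; rewrite !inE.
  by case: (i \in F I k); case: (i \in L I j).
by move=> i ikj; rewrite (greedy_top u ikj).
Qed.

Lemma usage_le_card k x j : (usage k x j <= #|F I k :&: L I j|)%N.
Proof. by rewrite ffunE -sum1_card; apply: leq_sum => i _; exact: leq_b1. Qed.

(** Serves to exchange x for the greedy action with its counts without changing the next state. *)
Lemma usage_greedy_usage k x : usage k (greedy k (usage k x)) = usage k x.
Proof.
by apply/ffunP => j; rewrite usage_greedy; apply/minn_idPl/usage_le_card.
Qed.

(** The dual bound becomes affine in x with nonpositive coefficients, so its dependence on x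
    separates over the blocks F_k :&: L_j. *)
Lemma excess_free (k : 'I_kf) x s :
  excess (beta I) (avail I k x) s =
  \sum_(i in F I k) Num.max (beta I i - s) 0
  - \sum_(i in F I k) Num.max (beta I i - s) 0 * (x i)%:R.
Proof.
rewrite -sumrB /excess (eq_bigl (fun i => (i \in F I k) && ~~ x i)); last first.
  by move=> i; rewrite inE.
rewrite big_mkcondr; apply: eq_bigr => i _.
by case: (x i); rewrite ?mulr1 ?mulr0 ?subrr ?subr0.
Qed.

(* By duality psi_k(x) is the minimum over s >= 0 of
   s f_k + sum_(i in F_k, x_i = 0) (beta_i - s)^+, and for each s the greedy
   choice removes as much as possible from that sum. *)
Lemma psi_greedy_le k x : psi I k (greedy k (usage k x)) <= psi I k x.
Proof.
(* [s] is an optimal multiplier for x and merely a feasible one for the greedy action, which is all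
   that weak duality asks. *)
have [s s0 ->] := psi_excess I k x.
apply: le_trans (psi_le_excess I k _ s0) _; rewrite lerD2l !excess_free lerD2l lerN2.
rewrite [leLHS](sum_blocks I) [leRHS](sum_blocks I); apply: ler_sum => j _.
set A := F I k :&: L I j; set u := usage k x.
rewrite [leRHS](_ : _ = \sum_(i in top (beta I) (u j) A) Num.max (beta I i - s) 0).
  apply: (@top_max _ _ (beta I) (fun i => Num.max (beta I i - s) 0)).
  - by move=> i; rewrite le_max lexx orbT.
  - by move=> i i' /prec_le ii'; rewrite le_max2 // lerD2r.
  - by move=> i _; rewrite ler0n lern1 leq_b1.
  by rewrite -natr_sum ler_nat /u ffunE.
rewrite [RHS](eq_bigl (fun i => (i \in A) && (i \in top (beta I) (u j) A))).
  rewrite big_mkcondr; apply: eq_bigr => i iA; rewrite (greedy_top u iA).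
  by case: (i \in top _ _ _); rewrite ?mulr1 ?mulr0.
by move=> i; rewrite !inE -andbA; case: (i \in F I k); case: (i \in L I j).
Qed.

(** The predecessors of i in F_k :&: L_j form an initial segment of that block, so ranks within the
    segment are ranks within the block, and the greedy action deletes its first u_j elements.
    Truncated subtraction accounts for the case where the whole segment is deleted. *)
Lemma rank_free_greedy k u i : i \in F I k ->
  rank (beta I) (avail I k (greedy k u)) i = (\sum_j (block_rank i j - u j))%N.
Proof.
move=> ik; rewrite /rank -sum1_card (sum_blocks I); apply: eq_bigr => j _.
set A := F I k :&: L I j; set B := [set i' in A | prec (beta I) i' i].
have rB i' : i' \in B -> rank (beta I) B i' = rank (beta I) A i'.
  rewrite inE => /andP[_ pi']; apply: eq_card => i''; rewrite !inE.
  case: (boolP (prec _ i'' i')) => pi''; rewrite ?andbF //.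
  by rewrite (prec_trans pi'' pi') andbT.
rewrite sum1_card.
transitivity #|B :\: top (beta I) (u j) B|.
  apply: eq_card => i'.
  rewrite -[LHS]/(i' \in [set i' in avail I k (greedy k u) | prec (beta I) i' i] :&: L I j).
  have [i'B|] := boolP (i' \in B); last first.
    move=> i'B; rewrite [RHS]inE (negbTE i'B) andbF; apply/negbTE.
    apply: contra i'B; rewrite !inE.
    by case: (i' \in F I k); case: (i' \in L I j); case: (prec _ _ _); rewrite ?andbF.
  have i'A : i' \in A by move: i'B; rewrite inE => /andP[].
  rewrite [RHS]inE [i' \in top _ _ _]inE i'B rB // !inE (greedy_top u i'A).
  rewrite [i' \in top _ _ _]inE i'A /=.
  by move: i'B; rewrite !inE => /andP[/andP[-> ->] ->]; rewrite !andbT.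
rewrite cardsD (setIidPr (top_sub _ _ _)) card_top.
rewrite /block_rank; move: ik; rewrite in_F => /eqP->.
by rewrite -/A -/(rank _ _ _) /rank -/B; lia.
Qed.

Lemma psi_greedy k u : psi I k (greedy k u) =
  \sum_(i in F I k)
     if (block_rank i (lidx I i) < u (lidx I i))%N then 0
     else if (\sum_j (block_rank i j - u j) < f I k)%N then beta I i else 0.
Proof.
rewrite psi_top; set A := avail _ _ _.
rewrite (eq_bigl (fun i => (i \in F I k) && (i \in top (beta I) (f I k) A))).
  rewrite big_mkcondr; apply: eq_bigr => i ik.
  rewrite [i \in top _ _ _]inE rank_free_greedy // inE ffunE ik /=.
  by case: ltnP.
by move=> i; rewrite !inE; case: (i \in F I k).
Qed.

(** * Mixed radix codes *)

(** Also meaningful at p = kl, where it is the number of states; the program reads that number from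
    the last entry of its weight table. *)
Definition weight p := (\prod_(j : 'I_kl | (j < p)%N) (l I j).+1)%N.

Definition decode (c : nat) : state := [ffun j : 'I_kl => c %/ weight j %% (l I j).+1]%N.

Lemma weightS j : weight j.+1 = (weight j * (l I j).+1)%N.
Proof.
exact: big_ord_ltS.
Qed.

Lemma weight0 : weight 0 = 1%N.
Proof. by rewrite /weight big_pred0. Qed.

Lemma weight_kl : weight kl = state_count I.
Proof. by apply: eq_bigl => j; rewrite ltn_ord. Qed.

Lemma weight_gt0 p : (0 < weight p)%N.
Proof. by rewrite /weight prodn_gt0. Qed.

Lemma weight_le p q : (p <= q)%N -> (weight p <= weight q)%N.
Proof.
move=> pq; rewrite /weight [leqRHS](bigID (fun j : 'I_kl => (j < p)%N)) /=.
rewrite [X in (_ <= X * _)%N](eq_bigl (fun j : 'I_kl => (j < p)%N)); last first.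
  by move=> j; case: (ltnP j p) => [/leq_trans->|]; rewrite ?andbF.
by rewrite leq_pmulr // prodn_gt0.
Qed.

Lemma decode_le c j : (decode c j <= l I j)%N.
Proof. by rewrite ffunE -ltnS ltn_mod. Qed.

Lemma decode0 : decode 0 = [ffun=> 0%N].
Proof. by apply/ffunP => j; rewrite !ffunE div0n mod0n. Qed.

Definition low_code r p := (\sum_(j : 'I_kl | (j < p)%N) r j * weight j)%N.

Lemma low_codeS r j : low_code r j.+1 = (low_code r j + r j * weight j)%N.
Proof.
exact: big_ord_ltS.
Qed.

Lemma low_code_lt r p : (forall j, r j <= l I j)%N -> (p <= kl)%N ->
  (low_code r p < weight p)%N.
Proof.
move=> rl; elim: p => [|p IH] pkl; first by rewrite /low_code big_pred0 ?weight_gt0.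
have := IH (ltnW pkl); rewrite (low_codeS r (Ordinal pkl)) (weightS (Ordinal pkl)) /=.
by have := rl (Ordinal pkl); nia.
Qed.

Lemma low_code_kl r : low_code r kl = state_code I r.
Proof. by apply: eq_bigl => j; rewrite ltn_ord. Qed.

Lemma code_lt r : (forall j, r j <= l I j)%N -> (state_code I r < state_count I)%N.
Proof. by move=> rl; rewrite -low_code_kl -weight_kl low_code_lt. Qed.

(** Descending induction from p = kl: each step moves the top digit of the low part into the
    multiplier h, as in Horner's scheme. *)
Lemma low_code_mod r p : (p <= kl)%N ->
  exists h, state_code I r = (low_code r p + weight p * h)%N.
Proof.
move=> pkl; rewrite -(subKn pkl); elim: (kl - p)%N (leq_subr p kl) => [_|d IH dkl].
  by exists 0%N; rewrite subn0 low_code_kl muln0 addn0.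
have [h ->] := IH (ltnW dkl).
have lt : (kl - d.+1 < kl)%N by lia.
have -> : (kl - d = (Ordinal lt).+1)%N by rewrite /=; lia.
rewrite low_codeS weightS; exists (r (Ordinal lt) + (l I (Ordinal lt)).+1 * h)%N.
by rewrite /=; nia.
Qed.

Lemma decode_code r : (forall j, r j <= l I j)%N -> decode (state_code I r) = r.
Proof.
move=> rl; apply/ffunP => j; rewrite ffunE.
have [h ->] := low_code_mod r (ltn_ord j).
rewrite low_codeS weightS.
rewrite (_ : _ + _ = (r j + h * (l I j).+1) * weight j + low_code r j)%N; last by nia.
rewrite divnMDl ?weight_gt0 // (divn_small (low_code_lt rl (ltnW (ltn_ord j)))).
by rewrite addn0 addnC modnMDl modn_small // ltnS.
Qed.

(** Lets one pass over the items accumulate the code, adding the weight of the leader block of each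
    interdicted item. *)
Lemma code_usage k x :
  (\sum_(i in F I k) x i * weight (lidx I i) = state_code I (usage k x))%N.
Proof.
rewrite (sum_blocks I); apply: eq_bigr => j _; rewrite ffunE big_distrl /=.
by apply: eq_bigr => i; rewrite inE in_L => /andP[_ /eqP->].
Qed.

(** Feasibility bounds each digit of the subtrahend by that of r, so no borrow occurs and vectors
    can be subtracted through their codes. *)
Lemma code_theta k r x : stage_action I k r x ->
  state_code I (theta I k r x) = (state_code I r - state_code I (usage k x))%N.
Proof.
move=> [_ xr]; rewrite /state_code -sumnB => [|j _].
  by apply: eq_bigr => j _; rewrite !ffunE mulnBl.
by rewrite leq_mul2r ffunE xr orbT.
Qed.

Lemma greedy_action k r u : (forall j, u j <= r j)%N ->
  stage_action I k r (greedy k u).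
Proof.
move=> ur; split=> [i|j]; first by rewrite ffunE => /andP[].
by have := usage_greedy k u j; rewrite ffunE => ->; rewrite geq_min ur.
Qed.

Lemma code_mono r u : (forall j, u j <= r j)%N -> (state_code I u <= state_code I r)%N.
Proof. by move=> ur; apply: leq_sum => j _; rewrite leq_mul2r ur orbT. Qed.

End Exchange.

(** * Correctness of the dynamic program *)

Section Optimality.
Context {R : realType} {n kl kf : nat} (I : instance R n kl kf).
Implicit Types (x y : bvec n) (i : 'I_n) (j : 'I_kl) (k : 'I_kf).
Local Notation state := {ffun 'I_kl -> nat}.
Implicit Types r u : state.

Lemma psi_ext k x y : {in F I k, x =1 y} -> psi I k x = psi I k y.
Proof.
move=> xy; rewrite !psi_top; suff -> : avail I k x = avail I k y by [].
apply/setP => i; rewrite !inE; have [ik|//] := boolP (i \in F I k).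
by rewrite xy.
Qed.

Lemma stage_state_le k r : stage_state I k r -> forall j, (r j <= l I j)%N.
Proof. by rewrite /stage_state; case: ifP => // _ -> j; rewrite ffunE. Qed.

Lemma stage_state_full k : k = 0%N :> nat -> stage_state I k (full_budget I).
Proof. by rewrite /stage_state => ->. Qed.

Lemma stage_state_theta k k' r x : k' = k.+1 :> nat -> stage_state I k r ->
  stage_state I k' (theta I k r x).
Proof.
move=> kk' /stage_state_le rl; rewrite /stage_state kk' /= => j.
by rewrite ffunE; apply: leq_trans (rl j); exact: leq_subr.
Qed.

Lemma sum_from k j x :
  (\sum_(i in L I j | k <= fidx I i) x i =
   \sum_(i in F I k :&: L I j) x i + \sum_(i in L I j | k < fidx I i) x i)%N.
Proof.
rewrite (bigID (fun i => fidx I i == k)) /=; congr addn; apply: eq_bigl => i.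
  rewrite inE in_F; case: eqP => [->|_]; rewrite ?andbF //.
  by rewrite leqnn !andbT.
by rewrite -andbA; congr andb; rewrite ltn_neqAle andbC eq_sym.
Qed.

Lemma psi_from k x : \sum_(k' : 'I_kf | (k <= k')%N) psi I k' x =
  psi I k x + \sum_(k' : 'I_kf | (k < k')%N) psi I k' x.
Proof.
rewrite (bigD1 k) //=; congr +%R; apply: eq_bigl => k'.
by rewrite ltn_neqAle andbC eq_sym.
Qed.

Lemma next_stage k :
  (exists2 k' : 'I_kf, k' = k.+1 :> nat & insub k.+1 = Some k') \/
  (kf = k.+1 /\ insub k.+1 = None :> option 'I_kf).
Proof.
case: insubP => [k' _ k'E|]; first by left; exists k'.
by rewrite -leqNgt => le; right; split=> //; apply/eqP; rewrite eqn_leq le ltn_ord.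
Qed.

Variables (V : 'I_kf -> state -> R) (xt : 'I_kf -> state -> bvec n).
Hypothesis bp : backward_pass I V xt.

Definition restrict k x : bvec n := [ffun i => (i \in F I k) && x i].

(** Induction on the number of remaining stages, for all states at once: the restriction of x to F_k
    is a feasible action, and the rest of x fits the budgets it leaves. *)
Lemma dp_lower k r x : stage_state I k r ->
  (forall j, \sum_(i in L I j | k <= fidx I i) x i <= r j)%N ->
  V k r <= \sum_(k' : 'I_kf | (k <= k')%N) psi I k' x.
Proof.
have [d] := ubnP (kf - k); elim: d => // d IH in k r *; rewrite ltnS => kd sr xr.
have [_ _ /(_ (restrict k x)) Vle] := bp sr.
have xkE j : (\sum_(i in F I k :&: L I j) restrict k x i =
              \sum_(i in F I k :&: L I j) x i)%N.
  by apply: eq_bigr => i; rewrite !inE ffunE => /andP[-> _].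
apply: le_trans (Vle _) _.
  split=> [i|j]; first by rewrite ffunE => /andP[].
  by rewrite xkE; apply: leq_trans (xr j); rewrite sum_from leq_addr.
rewrite psi_from /cost_to_go lerD //.
  by rewrite le_eqVlt; apply/orP; left; apply/eqP/psi_ext => i ik; rewrite ffunE ik.
have [[k' kk' ->]|[kE ->]] /= := next_stage k; last first.
  rewrite big_pred0 // => k'; apply/negbTE; rewrite -leqNgt -ltnS -[X in (_ < X)%N]kE.
  exact: ltn_ord.
rewrite -kk'; apply: IH; first by have := ltn_ord k'; lia.
  exact: stage_state_theta kk' sr.
move=> j; rewrite kk' ffunE xkE; move: (xr j); rewrite sum_from.
set a := (\sum_(i in _ :&: _) _)%N; set b := (\sum_(i in L I j | _) _)%N; lia.
Qed.

Variables (rs : 'I_kf -> state) (x : bvec n).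
Hypothesis fp : forward_pass I xt rs x.

Lemma stage_state_rs k : stage_state I k (rs k).
Proof.
have [rs0 rsS _] := fp; case: k => k; elim: k => [|k IH] lt.
  by rewrite rs0 //; exact: stage_state_full.
have lt' := ltnW lt; rewrite (rsS (Ordinal lt')) //.
exact: stage_state_theta (IH lt').
Qed.

(** The counterpart of [dp_lower]: the returned x attains the table values along its own trajectory.
    Feasibility of its tail travels with the value in one induction backward from the last stage. *)
Lemma dp_forward k :
  V k (rs k) = \sum_(k' : 'I_kf | (k <= k')%N) psi I k' x /\
  (forall j, \sum_(i in L I j | k <= fidx I i) x i <= rs k j)%N.
Proof.
have [_ rsS xE] := fp.
have [d] := ubnP (kf - k); elim: d => // d IH in k *; rewrite ltnS => kd.
have [[_ act] VE _] := bp (stage_state_rs k).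
have xkE j : (\sum_(i in F I k :&: L I j) xt k (rs k) i =
              \sum_(i in F I k :&: L I j) x i)%N.
  by apply: eq_bigr => i; rewrite inE => /andP[ik _]; rewrite (xE k).
rewrite VE psi_from /cost_to_go.
rewrite (psi_ext (y := x)); last by move=> i ik; rewrite (xE k).
have [[k' kk' ->]|[kE ->]] /= := next_stage k; last first.
  have none i : (k < fidx I i)%N = false.
    by apply/negbTE; rewrite -leqNgt -ltnS -[X in (_ < X)%N]kE; exact: ltn_ord.
  split=> [|j].
    rewrite [in RHS]big_pred0 // => k'; apply/negbTE.
    by rewrite -leqNgt -ltnS -[X in (_ < X)%N]kE; exact: ltn_ord.
  rewrite sum_from [X in (_ + X)%N]big_pred0 ?addn0; last by move=> i; rewrite none andbF.
  by rewrite -xkE act.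
have [|IHv IHx] := IH k'; first by have := ltn_ord k'; lia.
rewrite -(rsS _ _ kk') IHv kk'; split=> // j; rewrite sum_from.
have := IHx j; rewrite kk' (rsS _ _ kk') ffunE -xkE => le.
by rewrite -(subnKC (act j)) leq_add2l.
Qed.

End Optimality.

(** At stage 0 with the full budget the tail is all of x: [dp_forward] gives attainment and
    feasibility, [dp_lower] the bound for every competitor. *)
Lemma dp_run_correct (R : realType) n kl kf (I : instance R n kl kf) V xt x v :
  dp_run I V xt x v -> optimal_solution I x /\ v = optimal_value I.
Proof.
case=> bp [rs fp] [k k0 ->].
have all_stages (k' : 'I_kf) : (k <= k')%N by rewrite k0.
have rsk : rs k = full_budget I by case: fp => ->.
have [Vx xl] := dp_forward bp fp k.
have vE : V k (full_budget I) = follower_value I x.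
  by rewrite follower_psi -rsk Vx; apply: eq_bigl.
have xI : in_IX I x.
  move=> j; have := xl j; rewrite rsk ffunE; apply: leq_trans.
  by rewrite [leqRHS](eq_bigl (mem (L I j))) // => i; rewrite all_stages andbT.
suff opt : optimal_value I = follower_value I x by rewrite vE; split; first split.
apply: minimum_eq; first by exists x.
move=> _ [y yI ->]; rewrite -vE follower_psi.
have := @dp_lower _ _ _ _ I V xt bp k (full_budget I) y (stage_state_full _ k0).
rewrite [X in _ <= X](eq_bigl predT) //; apply => j; rewrite ffunE.
apply: leq_trans (yI j).
by rewrite [leqLHS](eq_bigl (mem (L I j))) // => i; rewrite all_stages andbT.
Qed.

(** * A program logic for the real RAM *)

(** Frame conditions are tracked per array and syntactically, so that they are decided by
    computation. *)
Fixpoint iwrites c : seq nat :=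
  match c with
  | Skip | RSet _ _ _ => [::]
  | ISet a _ _ => [:: a]
  | Seq c1 c2 | If _ c1 c2 => iwrites c1 ++ iwrites c2
  | While _ c => iwrites c
  end.

Fixpoint rwrites c : seq nat :=
  match c with
  | Skip | ISet _ _ _ => [::]
  | RSet a _ _ => [:: a]
  | Seq c1 c2 | If _ c1 c2 => rwrites c1 ++ rwrites c2
  | While _ c => rwrites c
  end.

Definition var v := IGet v (ILit 0).
Definition iadd := IBin IAdd.
Definition isub := IBin ISub.
Definition imul := IBin IMul.
Definition incr e := iadd e (ILit 1).

(** v < e is tested as v + 1 <= e, so the last test evaluates e + 1: hence the premise [N.+1 < w] of
    [wp_for]. *)
Definition For v e body :=
  Seq (ISet v (ILit 0) (ILit 0))
      (While (BLeI (incr (var v)) e) (Seq body (ISet v (ILit 0) (incr (var v))))).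

Section Calculus.
Context {R : realType}.
Implicit Types (m : memory R) (c : cmd).

Definition keeps c m m' :=
  (forall a p, a \notin iwrites c -> ints m' a p = ints m a p) /\
  (forall a p, a \notin rwrites c -> reals m' a p = reals m a p).

Lemma keeps_trans c m2 m1 m3 : keeps c m1 m2 -> keeps c m2 m3 -> keeps c m1 m3.
Proof.
move=> [i12 r12] [i23 r23].
by split=> a p na; [rewrite i23 ?i12 | rewrite r23 ?r12].
Qed.

Lemma keeps_sub c c' m m' : {subset iwrites c <= iwrites c'} ->
  {subset rwrites c <= rwrites c'} -> keeps c m m' -> keeps c' m m'.
Proof.
by move=> si sr [ki kr]; split=> a p na; [apply: ki|apply: kr]; apply: contra na;
  [exact: si|exact: sr].
Qed.

Lemma update_other (T : Type) (h : nat -> nat -> T) a p x a' p' :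
  a' != a -> update h a p x a' p' = h a' p'.
Proof. by rewrite /update => /negbTE->. Qed.

Lemma update_elsewhere (T : Type) (h : nat -> nat -> T) a p x p' :
  p' != p -> update h a p x a p' = h a p'.
Proof. by rewrite /update => /negbTE->; rewrite andbF. Qed.

Lemma update_same (T : Type) (h : nat -> nat -> T) a p x : update h a p x a p = x.
Proof. by rewrite /update !eqxx. Qed.

Definition iput m a p x := Memory (update (ints m) a p x) (reals m).
Definition rput m a p x := Memory (ints m) (update (reals m) a p x).

Variable w : nat.

Lemma exec_keeps c m m' t : exec w c m m' t -> keeps c m m'.
Proof.
elim=> {c m m' t} //=.
- move=> m a e1 e2 _ _; split=> a' p //=; rewrite inE; exact: update_other.
- move=> m a e1 e2 _ _; split=> a' p //=; rewrite inE; exact: update_other.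
- move=> m1 m2 m3 c1 c2 t1 t2 _ k1 _ k2; apply: (@keeps_trans _ m2).
    by apply: keeps_sub k1 => a; rewrite mem_cat => ->.
  by apply: keeps_sub k2 => a; rewrite mem_cat orbC => ->.
- move=> m m' b c1 c2 t _ _; case: ifP => _; apply: keeps_sub => a /=;
    by rewrite mem_cat => ->; rewrite ?orbT.
- by move=> m1 m2 m3 b c t1 t2 _ _ _ k1 _; exact: keeps_trans.
Qed.

Definition iev m e v := iok w m e /\ ieval m e = v.
Definition rev m e v := rok w m e /\ reval m e = v.
Definition bev m b v := bok w m b /\ beval m b = v.

Lemma iev_lit m v : (v < w)%N -> iev m (ILit v) v.
Proof. by move=> vw; rewrite /iev /= vw. Qed.

Lemma iev_get m a e p v : iev m e p -> ints m a p = v -> (v < w)%N ->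
  iev m (IGet a e) v.
Proof. by move=> [ok <-] <- lt; split; rewrite //= lt. Qed.

Lemma iev_bin m o e1 e2 v1 v2 : iev m e1 v1 -> iev m e2 v2 ->
  (iop_eval o v1 v2 < w)%N -> iev m (IBin o e1 e2) (iop_eval o v1 v2).
Proof. by move=> [ok1 <-] [ok2 <-] lt; split; rewrite //= lt ok1 ok2. Qed.

Lemma iev_add m e1 e2 v1 v2 : iev m e1 v1 -> iev m e2 v2 ->
  (v1 + v2 < w)%N -> iev m (iadd e1 e2) (v1 + v2)%N.
Proof. by move=> ev1 ev2; exact: (iev_bin (o := IAdd) ev1 ev2). Qed.

Lemma iev_mul m e1 e2 v1 v2 : iev m e1 v1 -> iev m e2 v2 ->
  (v1 * v2 < w)%N -> iev m (imul e1 e2) (v1 * v2)%N.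
Proof. by move=> ev1 ev2; exact: (iev_bin (o := IMul) ev1 ev2). Qed.

Lemma iev_lt m e v : iev m e v -> (v < w)%N.
Proof. by case=> + <-; case: e => [c|a e|o e1 e2] /= /andP[]. Qed.

Lemma iev_sub m e1 e2 v1 v2 : iev m e1 v1 -> iev m e2 v2 -> iev m (isub e1 e2) (v1 - v2)%N.
Proof.
move=> ev1 ev2; apply: (iev_bin (o := ISub) ev1 ev2).
exact: leq_ltn_trans (leq_subr _ _) (iev_lt ev1).
Qed.

Lemma iev_div m e1 e2 v1 v2 : iev m e1 v1 -> iev m e2 v2 ->
  iev m (IBin IDiv e1 e2) (v1 %/ v2)%N.
Proof.
move=> ev1 ev2; apply: (iev_bin (o := IDiv) ev1 ev2).
exact: leq_ltn_trans (leq_div _ _) (iev_lt ev1).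
Qed.

Lemma iev_mod m e1 e2 v1 v2 : iev m e1 v1 -> iev m e2 v2 ->
  iev m (IBin IMod e1 e2) (v1 %% v2)%N.
Proof.
move=> ev1 ev2; apply: (iev_bin (o := IMod) ev1 ev2).
exact: leq_ltn_trans (leq_mod _ _) (iev_lt ev1).
Qed.

Lemma iev_var m v x : ints m v 0 = x -> (x < w)%N -> iev m (var v) x.
Proof. by move=> <- lt; split; rewrite //= lt (leq_ltn_trans _ lt). Qed.

Lemma iev_incr m e v : iev m e v -> (v.+1 < w)%N -> iev m (incr e) v.+1.
Proof.
move=> ev lt; rewrite -addn1; apply: (iev_bin (o := IAdd)) => //=.
  by apply: iev_lit; apply: leq_ltn_trans lt.
by rewrite addn1.
Qed.

Lemma rev_zero m : rev m RZero 0.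
Proof. by []. Qed.

Lemma rev_get m a e p v : iev m e p -> reals m a p = v -> rev m (RGet a e) v.
Proof. by move=> [ok <-] <-. Qed.

Lemma rev_add m e1 e2 v1 v2 : rev m e1 v1 -> rev m e2 v2 -> rev m (RAdd e1 e2) (v1 + v2).
Proof. by move=> [ok1 <-] [ok2 <-]; split; rewrite //= ok1 ok2. Qed.

Lemma bev_lei m e1 e2 v1 v2 : iev m e1 v1 -> iev m e2 v2 ->
  bev m (BLeI e1 e2) (v1 <= v2)%N.
Proof. by move=> [ok1 <-] [ok2 <-]; split; rewrite //= ok1 ok2. Qed.

Lemma bev_ler m e1 e2 v1 v2 : rev m e1 v1 -> rev m e2 v2 ->
  bev m (BLeR e1 e2) (v1 <= v2).
Proof. by move=> [ok1 <-] [ok2 <-]; split; rewrite //= ok1 ok2. Qed.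

Lemma bev_not m b v : bev m b v -> bev m (BNot b) (~~ v).
Proof. by move=> [ok <-]. Qed.

Lemma bev_and m b1 b2 v1 v2 : bev m b1 v1 -> bev m b2 v2 ->
  bev m (BAnd b1 b2) (v1 && v2).
Proof. by move=> [ok1 <-] [ok2 <-]; split; rewrite //= ok1 ok2. Qed.

Variable bound : bexp -> nat.

(* An upper bound on the running time when the guard b of a loop succeeds at
   most [bound b] times. *)
Fixpoint time c : nat :=
  match c with
  | Skip => 1
  | ISet _ e1 e2 => (icost e1 + icost e2).+1
  | RSet _ e1 e2 => (icost e1 + rcost e2).+1
  | Seq c1 c2 => time c1 + time c2
  | If b c1 c2 => (bcost b + (time c1 + time c2)).+1
  | While b c => (bound b).+1 * (bcost b + time c).+1
  end.

(** Total correctness within the syntactic bound [time]. Invariants thus never mention running time,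
    and the bound is estimated afterwards from the program text and the loop bounds alone. *)
Definition wp c (Q : memory R -> Prop) m :=
  exists m' t, [/\ exec w c m m' t, (t <= time c)%N & Q m'].

(** The frame [keeps] comes for free from the execution, so specifications state only what
    changes. *)
Lemma wp_conseq c (P Q : memory R -> Prop) m :
  wp c P m -> (forall m', keeps c m m' -> P m' -> Q m') -> wp c Q m.
Proof.
move=> [m' [t [ex le p]]] pq; exists m', t; split=> //.
by apply: pq p; exact: exec_keeps ex.
Qed.

Lemma wp_skip (Q : memory R -> Prop) m : Q m -> wp Skip Q m.
Proof. by move=> q; exists m, 1%N; split=> //; exact: exec_skip. Qed.

Lemma wp_iset (Q : memory R -> Prop) m a e1 e2 p x : iev m e1 p -> iev m e2 x ->
  Q (iput m a p x) -> wp (ISet a e1 e2) Q m.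
Proof.
move=> [ok1 <-] [ok2 <-] q.
by exists (iput m a (ieval m e1) (ieval m e2)); eexists; split; [exact: exec_iset| |].
Qed.

Lemma wp_rset (Q : memory R -> Prop) m a e1 e2 p x : iev m e1 p -> rev m e2 x ->
  Q (rput m a p x) -> wp (RSet a e1 e2) Q m.
Proof.
move=> [ok1 <-] [ok2 <-] q.
by exists (rput m a (ieval m e1) (reval m e2)); eexists; split; [exact: exec_rset| |].
Qed.

Lemma wp_seq (Q : memory R -> Prop) m c1 c2 :
  wp c1 (wp c2 Q) m -> wp (Seq c1 c2) Q m.
Proof.
move=> [m1 [t1 [ex1 le1 [m2 [t2 [ex2 le2 q]]]]]].
by exists m2, (t1 + t2)%N; split=> //; [exact: exec_seq ex1 ex2|exact: leq_add].
Qed.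

Lemma wp_if (Q : memory R -> Prop) m b c1 c2 (v : bool) : bev m b v ->
  (v -> wp c1 Q m) -> (~~ v -> wp c2 Q m) -> wp (If b c1 c2) Q m.
Proof.
move=> [ok bv] q1 q2.
have [m' [t [ex le q]]] : wp (if beval m b then c1 else c2) Q m.
  by rewrite bv; case: (v) q1 q2 => [/(_ isT)|_ /(_ isT)].
exists m', (bcost b + t).+1; split=> //=; first exact: exec_if.
rewrite ltnS leq_add2l; apply: leq_trans le _.
by case: (beval m b); rewrite ?leq_addr ?leq_addl.
Qed.

(** The frame is relative to the memory [m] before the loop, which keeps facts about untouched
    arrays out of [Inv]. The bound [e] is evaluated anew at each test and has to keep the value
    N. *)
Lemma wp_for (Inv : nat -> memory R -> Prop) (Q : memory R -> Prop) N m v e body :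
  v \notin iwrites body ->
  (N.+1 < w)%N -> (N <= bound (BLeI (incr (var v)) e))%N ->
  (forall m', keeps (For v e body) m m' -> iev m' e N) ->
  Inv 0%N (iput m v 0 0) ->
  (forall p m', (p < N)%N -> keeps (For v e body) m m' -> ints m' v 0 = p ->
     Inv p m' -> wp body (fun m'' => Inv p.+1 (iput m'' v 0 p.+1)) m') ->
  (forall m', keeps (For v e body) m m' -> Inv N m' -> Q m') ->
  wp (For v e body) Q m.
Proof.
move=> vb Nw Nb eN inv0 step post; apply: wp_seq.
have w0 : (0 < w)%N by apply: leq_ltn_trans Nw.
apply: wp_iset; [exact: iev_lit|exact: iev_lit|].
set c := For v e body in eN step post *; set b := BLeI _ e.
set K := (bcost b + time (Seq body (ISet v (ILit 0) (incr (var v))))).+1.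
(* Induction on the number d of remaining rounds; the extra unit in [d.+1 * K] pays for the failing
   test. *)
suff loop d p m' : (p + d = N)%N -> keeps c m m' -> ints m' v 0 = p -> Inv p m' ->
    exists m'' t, [/\ exec w (While b (Seq body (ISet v (ILit 0) (incr (var v))))) m' m'' t,
      (t <= d.+1 * K)%N & Q m''].
  have [||||m' [t [ex le q]]] := loop N 0%N (iput m v 0 0) => //.
    split=> a p //= na; apply: update_other.
      by apply: contraNneq na => ->; rewrite /c /= inE eqxx.
    exact: update_same.
  exists m', t; split=> //; apply: leq_trans le _.
  by rewrite [time _]/= -/K leq_mul2r ltnS Nb orbT.
have guard q m1 : (q <= N)%N -> keeps c m m1 -> ints m1 v 0 = q -> bev m1 b (q < N)%N.
  move=> qN k1 vq; apply: bev_lei; last exact: eN.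
  by apply: iev_incr; [apply: iev_var => //|]; lia.
elim: d p m' => [|d IH] p m' pd km vp inv; have [bok bE] := guard p m' ltac:(lia) km vp.
  exists m', (bcost b).+1; split.
  - by apply: exec_while_end => //; rewrite bE; lia.
  - by rewrite mul1n /K ltnS leq_addr.
  - by apply: post => //; rewrite -pd addn0.
have lt : (p < N)%N by lia.
have [m1 [t1 [ex1 le1 inv1]]] := step _ _ lt km vp inv.
have [k1i k1r] := exec_keeps ex1.
have v1 : ints m1 v 0 = p by rewrite k1i.
have [i1ok i1E] : iev m1 (incr (var v)) p.+1.
  by apply: iev_incr; [apply: iev_var => //|]; lia.
have [||||m2 [t2 [ex2 le2 q]]] := IH p.+1 (iput m1 v 0 p.+1).
- by rewrite addSnnS.
- apply: keeps_trans km _; split=> a q na /=.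
    move: na; rewrite /c /= inE mem_cat !negb_or => /and3P[av ab _].
    by rewrite update_other // k1i.
  by rewrite k1r //; move: na; rewrite /c /= cats0.
- exact: update_same.
- exact: inv1.
exists m2, (bcost b + (t1 + (1 + icost (incr (var v))).+1) + t2).+1; split=> //.
  apply: exec_while_step ex2 => //; first by rewrite bE.
  apply: exec_seq ex1 _; rewrite /iput -[X in update _ _ X _]/(ieval m1 (ILit 0)) -i1E.
  by apply: exec_iset => //=; rewrite w0.
rewrite mulSn -addSn; apply: leq_add le2; rewrite /K /= ltnS leq_add2l.
by rewrite leq_add2r.
Qed.

End Calculus.

Arguments wp_skip {R w bound Q m}.
Arguments wp_iset {R w bound Q m a e1 e2 p x}.
Arguments wp_rset {R w bound Q m a e1 e2 p x}.
Arguments wp_seq {R w bound Q m c1 c2}.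
Arguments wp_if {R w bound Q m b c1 c2 v}.
Arguments wp_for {R w bound} Inv {Q} N {m v e body}.
Arguments wp_conseq {R w bound c P Q m}.

(** Cells of a table stored row by row do not alias. *)
Lemma mulD_inj s k c k' c' : (c < s)%N -> (c' < s)%N ->
  (k * s + c = k' * s + c')%N -> k = k' /\ c = c'.
Proof.
move=> cs c's e; have s0 : (0 < s)%N by exact: leq_ltn_trans cs.
have := congr1 (divn^~ s) e; rewrite !divnMDl // !divn_small // !addn0 => kk'.
by split=> //; move: e; rewrite kk' => /addnI.
Qed.

(** * The program *)

(* Integer arrays 0-6 and real arrays 0-2 are those of the input and output
   conventions; 7 holds the weights of the mixed radix code, 8 the ranks of the
   elements within the blocks, 9 the best interdiction counts found so far;
   arrays from 10 on, and real array 3, hold scalars in entry 0. *)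
Local Notation vI := 10%N.
Local Notation vI' := 11%N.
Local Notation vJ := 12%N.
Local Notation vR := 13%N.
Local Notation vU := 14%N.
Local Notation vT := 15%N.
Local Notation vUsed := 16%N.
Local Notation vC := 17%N.
Local Notation vK := 18%N.
Local Notation vS := 19%N.
Local Notation vS' := 20%N.

Definition num_items := IGet 0 (ILit 0).
Definition num_L := IGet 0 (ILit 1).
Definition num_F := IGet 0 (ILit 2).
Definition num_states := IGet 7 num_L.
Definition L_of e := IGet 1 e.
Definition F_of e := IGet 2 e.
Definition digit e ej := IBin IMod (IBin IDiv e (IGet 7 ej)) (incr (IGet 3 ej)).
Definition rank_of ei ej := IGet 8 (iadd (imul ei num_L) ej).
Definition BEqI e1 e2 := BAnd (BLeI e1 e2) (BLeI e2 e1).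
Definition BLtI e1 e2 := BNot (BLeI e2 e1).

Definition weights_prog :=
  Seq (ISet 7 (ILit 0) (ILit 1))
      (For vJ num_L (ISet 7 (incr (var vJ)) (imul (IGet 7 (var vJ)) (incr (IGet 3 (var vJ)))))).

Definition precedes i' i :=
  BAnd (BLeR (RGet 0 i) (RGet 0 i')) (BNot (BAnd (BLeR (RGet 0 i') (RGet 0 i)) (BLeI i i'))).

Definition ranks_prog :=
  For vI num_items
    (Seq (For vJ num_L (ISet 8 (iadd (imul (var vI) num_L) (var vJ)) (ILit 0)))
         (For vI' num_items
            (If (BAnd (BEqI (F_of (var vI')) (F_of (var vI))) (precedes (var vI') (var vI)))
                (ISet 8 (iadd (imul (var vI) num_L) (L_of (var vI')))
                        (incr (rank_of (var vI) (L_of (var vI')))))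
                Skip))).

Definition removed u := BLtI (rank_of (var vI) (L_of (var vI))) (digit u (L_of (var vI))).

Definition psi_prog :=
  Seq (RSet 3 (ILit 0) RZero)
  (Seq (ISet vUsed (ILit 0) (ILit 0))
  (For vI num_items
    (If (BEqI (F_of (var vI)) (var vK))
      (If (removed (var vU))
        (ISet vUsed (ILit 0) (iadd (var vUsed) (IGet 7 (L_of (var vI)))))
        (Seq (ISet vC (ILit 0) (ILit 0))
        (Seq (For vJ num_L
               (ISet vC (ILit 0)
                  (iadd (var vC) (isub (rank_of (var vI) (var vJ)) (digit (var vU) (var vJ))))))
             (If (BLtI (var vC) (IGet 4 (var vK)))
               (RSet 3 (ILit 0) (RAdd (RGet 3 (ILit 0)) (RGet 0 (var vI))))
               Skip))))
      Skip))).

Definition value_at ek er := RGet 2 (iadd (imul ek num_states) er).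
Definition candidate :=
  RAdd (RGet 3 (ILit 0)) (value_at (incr (var vK)) (isub (var vR) (var vUsed))).

(** The counts 0 come first and are feasible in every state; the test that u is at least 1 makes
    them overwrite whatever the tables held, which replaces an initialization. *)
Definition improve_prog :=
  For vR num_states
    (Seq (ISet vC (ILit 0) (ILit 1))
    (Seq (For vJ num_L
           (If (BLeI (digit (var vU) (var vJ)) (digit (var vR) (var vJ))) Skip
               (ISet vC (ILit 0) (ILit 0))))
    (If (BLeI (ILit 1) (var vC))
      (If (BAnd (BLeI (ILit 1) (var vU)) (BLeR (value_at (var vK) (var vR)) candidate))
        Skip
        (Seq (RSet 2 (iadd (imul (var vK) num_states) (var vR)) candidate)
             (ISet 9 (var vR) (var vU))))
      Skip))).

(** Bits are written once per stage. Writing n of them at each improvement could cost n^(2 kl + 1)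
    per stage, one factor n too much overall. *)
Definition store_prog :=
  For vR num_states
    (For vI num_items
      (If (BEqI (F_of (var vI)) (var vK))
        (If (removed (IGet 9 (var vR)))
          (ISet 6 (iadd (imul (var vR) num_items) (var vI)) (ILit 1))
          (ISet 6 (iadd (imul (var vR) num_items) (var vI)) (ILit 0)))
        Skip)).

Definition stage_prog :=
  Seq (ISet vK (ILit 0) (isub num_F (incr (var vT))))
  (Seq (For vU num_states (Seq psi_prog improve_prog)) store_prog).

(** Row kf is set to zero, in place of the missing second term of [cost_to_go] at the last stage;
    all stages then run the same code. *)
Definition backward_prog :=
  Seq (For vR num_states (RSet 2 (iadd (imul num_F num_states) (var vR)) RZero))
      (For vT num_F stage_prog).

Definition stored_bit := IGet 6 (iadd (imul (var vS) num_items) (var vI)).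

(** The full budget has the largest code, S - 1. The next state is built in [vS'], as the bits of
    the current stage are read in the row of the old state [vS]. *)
Definition forward_prog :=
  Seq (ISet vS (ILit 0) (isub num_states (ILit 1)))
  (Seq (For vK num_F
    (Seq (ISet vS' (ILit 0) (var vS))
    (Seq (For vI num_items
           (If (BEqI (F_of (var vI)) (var vK))
             (Seq (ISet 5 (var vI) stored_bit)
                  (ISet vS' (ILit 0)
                     (isub (var vS') (imul stored_bit (IGet 7 (L_of (var vI)))))))
             Skip))
         (ISet vS (ILit 0) (var vS')))))
  (RSet 1 (ILit 0) (RGet 2 (isub num_states (ILit 1))))).

Definition dp_prog :=
  Seq weights_prog (Seq ranks_prog (Seq backward_prog forward_prog)).

(** Every loop of the program runs up to n, kl, kf or the number of states; which one is read off
    from the place where the right side of its guard is stored. *)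
Definition loop_bound n kl kf S b : nat :=
  match b with
  | BLeI _ (IGet 0 (ILit 0)) => n
  | BLeI _ (IGet 0 (ILit 1)) => kl
  | BLeI _ (IGet 0 (ILit 2)) => kf
  | BLeI _ (IGet 7 _) => S
  | _ => 0
  end%N.

(** * Memory invariants and evaluation of the program's expressions *)

Section Verification.
Context {R : realType} {n kl kf : nat} (I : instance R n kl kf).
Implicit Types (m : memory R) (i : 'I_n) (j : 'I_kl) (k : 'I_kf).
Local Notation state := {ffun 'I_kl -> nat}.
Implicit Types (x : bvec n) (r u : state).
Local Notation S := (state_count I).

Variable w : nat.
(** The products are the tables of values (with the additional zero row), bits and ranks. The other
    terms cover weights, counts, scalars, literals and the last evaluation of a guard. *)
Hypothesis w_big :
  (kf.+1 * S + S * n + n * kl + n + kl + kf + S + 4 <= w)%N.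

Local Notation wp := (wp w (loop_bound n kl kf S)).
Local Notation iev := (iev w).
Local Notation bev := (bev w).
Local Notation rev := (rev w).

Definition data m :=
  [/\ [/\ ints m 0 0 = n, ints m 0 1 = kl & ints m 0 2 = kf],
      forall i, ints m 1 i = lidx I i,
      forall i, ints m 2 i = fidx I i,
      (forall j, ints m 3 j = l I j) /\ (forall k, ints m 4 k = f I k)
    & forall i, reals m 0 i = beta I i].

Definition weight_table m := forall p, (p <= kl)%N -> ints m 7 p = weight I p.

Definition rank_table m := forall i j, ints m 8 (i * kl + j)%N = block_rank I i j.

Definition ready m := [/\ data m, weight_table m & rank_table m].

Lemma data_keeps c m m' : keeps c m m' ->
  all (fun a => a \notin iwrites c) [:: 0; 1; 2; 3; 4]%N -> 0%N \notin rwrites c ->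
  data m -> data m'.
Proof.
move=> [ki kr] /and5P[a0 a1 a2 a3 /andP[a4 _]] r0 [[d0 d1 d2] dL dF [dl df] db].
by split; [split| | |split|] => *; rewrite ?ki ?kr.
Qed.

Lemma weight_table_keeps c m m' : keeps c m m' -> 7 \notin iwrites c ->
  weight_table m -> weight_table m'.
Proof. by move=> [ki _] a7 t p pkl; rewrite ki // t. Qed.

Lemma ready_keeps c m m' : keeps c m m' ->
  all (fun a => a \notin iwrites c) [:: 0; 1; 2; 3; 4; 7; 8]%N -> 0%N \notin rwrites c ->
  ready m -> ready m'.
Proof.
move=> km /= /and5P[a0 a1 a2 a3 /and4P[a4 a7 a8 _]] r0 [d wt rt]; split.
- by apply: data_keeps km _ r0 d; rewrite /= a0 a1 a2 a3 a4.
- exact: weight_table_keeps km a7 wt.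
- by move=> i j; rewrite (proj1 km).
Qed.

Lemma S_gt0 : (0 < S)%N.
Proof. by rewrite -weight_kl weight_gt0. Qed.

Lemma weight_ltw p : (p <= kl)%N -> (weight I p < w)%N.
Proof. by move=> /(weight_le I); rewrite weight_kl; have := w_big; lia. Qed.

Lemma l_ltS j : (l I j < S)%N.
Proof.
rewrite -weight_kl; apply: leq_trans (weight_le I (ltn_ord j)).
by rewrite weightS leq_pmull ?weight_gt0.
Qed.

Lemma f_le k : (f I k <= n)%N.
Proof. by apply: leq_trans (f_sum I); rewrite (bigD1 k) //= leq_addr. Qed.

Lemma row_ltw (k c : nat) : (k <= kf)%N -> (c < S)%N -> (k * S + c < w)%N.
Proof. by have := w_big; nia. Qed.

Lemma cell_ltw c i : (c < S)%N -> (c * n + i < w)%N.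
Proof. by have := ltn_ord i; have := w_big; nia. Qed.

Lemma rank_ltw i j : (i * kl + j < w)%N.
Proof. by have := ltn_ord i; have := ltn_ord j; have := w_big; nia. Qed.

Lemma block_rank_le i j : (block_rank I i j <= n)%N.
Proof. by rewrite -[leqRHS](card_ord n); exact: max_card. Qed.

Lemma ev_n m : data m -> iev m num_items n.
Proof.
move=> [[d0 d1 d2] _ _ _ _]; have := w_big => wb.
by apply: iev_get d0 _; [apply: iev_lit|]; lia.
Qed.

Lemma ev_kl m : data m -> iev m num_L kl.
Proof.
move=> [[d0 d1 d2] _ _ _ _]; have := w_big => wb.
by apply: iev_get d1 _; [apply: iev_lit|]; lia.
Qed.

Lemma ev_kf m : data m -> iev m num_F kf.
Proof.
move=> [[d0 d1 d2] _ _ _ _]; have := w_big => wb.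
by apply: iev_get d2 _; [apply: iev_lit|]; lia.
Qed.

Lemma ev_S m : data m -> weight_table m -> iev m num_states S.
Proof.
move=> d wt; have := w_big => wb.
apply: iev_get (ev_kl d) _ _; last by lia.
by rewrite -weight_kl wt.
Qed.

Lemma ev_L m e i : data m -> iev m e i -> iev m (L_of e) (lidx I i).
Proof.
move=> [_ dL _ _ _] ev; apply: iev_get ev (dL i) _.
by have := ltn_ord (lidx I i); have := w_big; lia.
Qed.

Lemma ev_F m e i : data m -> iev m e i -> iev m (F_of e) (fidx I i).
Proof.
move=> [_ _ dF _ _] ev; apply: iev_get ev (dF i) _.
by have := ltn_ord (fidx I i); have := w_big; lia.
Qed.

Lemma ev_ord m v i : ints m v 0 = i -> iev m (var v) i.
Proof. by move=> vi; apply: iev_var vi _; have := ltn_ord i; have := w_big; lia. Qed.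

Lemma ev_l m e j : data m -> iev m e j -> iev m (incr (IGet 3 e)) (l I j).+1.
Proof.
move=> [_ _ _ [dl _] _] ev; have := l_ltS j; have := w_big => wb lS.
by apply: iev_incr; [apply: iev_get ev (dl j) _|]; lia.
Qed.

Lemma ev_weight m e j : weight_table m -> iev m e j -> iev m (IGet 7 e) (weight I j).
Proof.
move=> wt ev; have jkl := ltnW (ltn_ord j).
exact: iev_get ev (wt _ jkl) (weight_ltw jkl).
Qed.

Lemma ev_digit m e c ej j : data m -> weight_table m -> iev m e c -> iev m ej j ->
  iev m (digit e ej) (decode I c j).
Proof.
move=> d wt ev evj; rewrite ffunE.
exact: iev_mod (iev_div ev (ev_weight wt evj)) (ev_l d evj).
Qed.

Lemma ev_rank_index m ei i ej j : data m -> iev m ei i -> iev m ej j ->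
  iev m (iadd (imul ei num_L) ej) (i * kl + j)%N.
Proof.
move=> d evi evj; apply: iev_add _ evj (rank_ltw i j).
apply: iev_mul evi (ev_kl d) _.
exact: leq_ltn_trans (leq_addr _ _) (rank_ltw i j).
Qed.

Lemma ev_rank m ei i ej j : data m -> rank_table m -> iev m ei i -> iev m ej j ->
  iev m (rank_of ei ej) (block_rank I i j).
Proof.
move=> d rt evi evj; apply: iev_get (ev_rank_index d evi evj) (rt i j) _.
by have := block_rank_le i j; have := w_big; lia.
Qed.

Lemma ev_row m ek (k : nat) er c : data m -> weight_table m -> iev m ek k -> iev m er c ->
  (k <= kf)%N -> (c < S)%N -> iev m (iadd (imul ek num_states) er) (k * S + c)%N.
Proof.
move=> d wt evk evr kkf cS; apply: iev_add _ evr (row_ltw kkf cS).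
apply: iev_mul evk (ev_S d wt) _.
exact: leq_ltn_trans (leq_addr _ _) (row_ltw kkf cS).
Qed.

Lemma ev_cell m er c ei i : data m -> iev m er c -> iev m ei i -> (c < S)%N ->
  iev m (iadd (imul er num_items) ei) (c * n + i)%N.
Proof.
move=> d evr evi cS; apply: iev_add _ evi (cell_ltw i cS).
apply: iev_mul evr (ev_n d) _.
exact: leq_ltn_trans (leq_addr _ _) (cell_ltw i cS).
Qed.

Lemma ev_eq m e1 e2 v1 v2 : iev m e1 v1 -> iev m e2 v2 -> bev m (BEqI e1 e2) (v1 == v2).
Proof.
move=> ev1 ev2; rewrite eqn_leq; apply: bev_and; exact: bev_lei.
Qed.

Lemma ev_lt m e1 e2 v1 v2 : iev m e1 v1 -> iev m e2 v2 -> bev m (BLtI e1 e2) (v1 < v2)%N.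
Proof. by move=> ev1 ev2; rewrite ltnNge; apply: bev_not; exact: bev_lei. Qed.

(** * The tables of weights and ranks *)

Lemma wp_weights m : data m -> wp weights_prog weight_table m.
Proof.
move=> d; have wb := w_big.
apply: wp_seq; apply: wp_iset; [by apply: iev_lit; lia|by apply: iev_lit; lia|].
apply: (wp_for (fun p m' => forall q, (q <= p)%N -> ints m' 7 q = weight I q) kl) => //.
- by lia.
- by move=> m' km; apply: ev_kl; apply: data_keeps km _ _ d.
- by move=> q; rewrite leqn0 => /eqP->; rewrite weight0.
- move=> p m' pkl km vp inv; pose j := Ordinal pkl.
  have d' : data m' by apply: data_keeps km _ _ d.
  have evj : iev m' (var vJ) j by apply: iev_var vp _; rewrite /=; lia.
  apply: (wp_iset (p := p.+1) (x := weight I p.+1)).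
  + by apply: iev_incr evj _; rewrite /=; lia.
  + rewrite (weightS I j); apply: iev_mul (ev_l d' evj) _.
      by apply: iev_get evj (inv _ (leqnn _)) _; apply: weight_ltw; exact: ltnW.
    by rewrite /= -(weightS I j); apply: weight_ltw.
  move=> q; rewrite leq_eqVlt => /orP[/eqP->|qp]; first exact: update_same.
  by rewrite /= update_other // update_elsewhere ?inv // ltn_eqF.
Qed.

Lemma ev_prec m e' i' e i : data m -> iev m e' i' -> iev m e i ->
  bev m (precedes e' e) (prec (beta I) i' i).
Proof.
move=> [_ _ _ _ db] ev' ev.
have rv' := rev_get ev' (db i'); have rv := rev_get ev (db i).
apply: bev_and; first exact: bev_ler.
apply/bev_not/bev_and; [exact: bev_ler | exact: bev_lei].
Qed.

Lemma lit_ltw c : (c <= 3)%N -> (c < w)%N.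
Proof. by have := w_big; lia. Qed.

Lemma rank_cell_neq i j i' j' : (i, j) != (i', j') -> (i * kl + j != i' * kl + j')%N.
Proof.
apply: contraNneq => /(mulD_inj (ltn_ord j) (ltn_ord j'))[/val_inj-> /val_inj->].
exact: eqxx.
Qed.

(** Each predecessor of i in its follower block lies in exactly one L_j, so a single pass over i'
    fills the kl cells of row i together. *)
Lemma wp_ranks m : data m -> wp ranks_prog rank_table m.
Proof.
move=> d; have wb := w_big.
apply: (wp_for (fun p m' => forall i j, (i < p)%N ->
  ints m' 8 (i * kl + j)%N = block_rank I i j) n) => //.
- by lia.
- by move=> m' km; apply: ev_n; apply: data_keeps km _ _ d.
- move=> p m1 pn k1 vp inv; pose i := Ordinal pn.
  have d1 : data m1 by apply: data_keeps k1 _ _ d.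
  have {}vp : ints m1 vI 0 = i by [].
  apply: wp_seq; apply: (wp_for (fun q m' => (forall i j, (i < p)%N ->
    ints m' 8 (i * kl + j)%N = block_rank I i j) /\
    forall j, (j < q)%N -> ints m' 8 (i * kl + j)%N = 0%N) kl) => //.
  + by lia.
  + by move=> m' km; apply: ev_kl; apply: data_keeps km _ _ d1.
  + move=> q m2 qkl k2 vq [inv1 inv2]; pose j := Ordinal qkl.
    have d2 : data m2 by apply: data_keeps k2 _ _ d1.
    have vi : iev m2 (var vI) i by apply: ev_ord; rewrite (proj1 k2).
    have vj : iev m2 (var vJ) j by apply: iev_var vq _; rewrite /=; lia.
    apply: (wp_iset (ev_rank_index d2 vi vj)).
      by apply: iev_lit; exact: lit_ltw.
    split=> [i' j' i'p|j' jq] /=; rewrite update_other //.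
      rewrite update_elsewhere ?inv1 //; apply: (@rank_cell_neq i' j' i j).
      by apply: contraTneq i'p => -[-> _]; rewrite ltnn.
    have [->|ne] := eqVneq j' j; first exact: update_same.
    rewrite update_elsewhere ?inv2 //; last first.
      by apply: (@rank_cell_neq i j' i j); rewrite xpair_eqE eqxx.
    by rewrite ltn_neqAle ne -ltnS.
  move=> m2 k2 [inv1 inv2].
  have d2 : data m2 by apply: data_keeps k2 _ _ d1.
  have vi2 : ints m2 vI 0 = i by rewrite (proj1 k2).
  pose cond i' j := (i' \in F I (fidx I i) :&: L I j) && prec (beta I) i' i.
  apply: (wp_for (fun q m' => (forall i j, (i < p)%N ->
    ints m' 8 (i * kl + j)%N = block_rank I i j) /\
    forall j, ints m' 8 (i * kl + j)%N = \sum_(i' < n | (i' < q)%N) cond i' j)%N n) => //.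
  + by lia.
  + by move=> m' km; apply: ev_n; apply: data_keeps km _ _ d2.
  + by split=> // j; rewrite big_ord_lt0 /= update_other // inv2.
  + move=> q m3 qn k3 vq [inv1' inv2']; pose i' := Ordinal qn.
    have d3 : data m3 by apply: data_keeps k3 _ _ d2.
    have vi : iev m3 (var vI) i by apply: ev_ord; rewrite (proj1 k3).
    have vi' : iev m3 (var vI') i' by apply: ev_ord.
    have condE j : cond i' j = (fidx I i' == fidx I i) && prec (beta I) i' i &&
        (lidx I i' == j).
      by rewrite /cond inE in_F in_L andbAC.
    apply: (wp_if (v := (fidx I i' == fidx I i) && prec (beta I) i' i)).
    * by apply: bev_and; [apply: ev_eq; exact: ev_F|exact: ev_prec].
    * move=> c; have vl := ev_L d3 vi'.
      have ir := ev_rank_index d3 vi vl.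
      apply: (wp_iset ir).
        apply: iev_incr; first apply: iev_get ir (inv2' _) _.
          apply: leq_ltn_trans (_ : n < w)%N; last by lia.
          apply: leq_trans (leq_sum _ (fun i _ => leq_b1 _)) _.
          by rewrite sum1_card -[leqRHS](card_ord n) max_card.
        apply: leq_ltn_trans (_ : n.+1 < w)%N; last by lia.
        rewrite ltnS; apply: leq_trans (leq_sum _ (fun i _ => leq_b1 _)) _.
        by rewrite sum1_card -[leqRHS](card_ord n) max_card.
      split=> [i'' j' i''p|j'] /=; rewrite update_other //.
        rewrite update_elsewhere ?inv1' //; apply: (@rank_cell_neq i'' j' i (lidx I i')).
        by apply: contraTneq i''p => -[-> _]; rewrite ltnn.
      rewrite (big_ord_ltS _ _ i') condE c /=.
      case: eqVneq => [<-|ne]; first by rewrite update_same addn1.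
      rewrite update_elsewhere ?inv2' ?addn0 //.
      by apply: (@rank_cell_neq i j' i (lidx I i')); rewrite xpair_eqE eqxx /= eq_sym.
    * move=> c; apply: wp_skip; split=> // j /=.
      by rewrite update_other // (big_ord_ltS _ _ i') condE (negbTE c) /= addn0.
  move=> m3 k3 [inv1' inv2'] i' j i'p /=; rewrite update_other //.
  move: i'p; rewrite ltnS leq_eqVlt => /orP[/eqP i'p|/inv1'//].
  have -> : i' = i by exact: val_inj.
  rewrite inv2' big_ord_ltn /block_rank /rank -sum1_card [RHS]big_mkcond.
  by apply: eq_bigr => i'' _; rewrite [in RHS]inE /cond; case: ifP.
- by move=> m' _ inv i j; exact: inv.
Qed.

(** * The follower's value and the usage of a greedy action *)

Definition rank_excess i u := (\sum_j (block_rank I i j - u j))%N.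

Lemma usage_code_lt k u x : (forall j, u j <= l I j)%N -> stage_action I k u x ->
  (state_code I (usage I k x) < S)%N.
Proof.
by move=> ul [_ xu]; apply: code_lt => j; rewrite ffunE; apply: leq_trans (ul j).
Qed.

(** The L_j are disjoint, so all block ranks of i together count each item at most once; this keeps
    the counter of the machine in range. *)
Lemma rank_excess_le i u p : (\sum_(j < kl | (j < p)%N) (block_rank I i j - u j) <= n)%N.
Proof.
apply: leq_trans (_ : rank_excess i u <= n)%N.
  by rewrite /rank_excess big_mkcond; apply: leq_sum => j _; case: ifP.
apply: leq_trans (_ : \sum_j block_rank I i j <= n)%N.
  by apply: leq_sum => j _; exact: leq_subr.
rewrite -[leqRHS](card_ord n) -sum1_card (partition_big (lidx I) predT) //=.
apply: leq_sum => j _; rewrite /block_rank /rank -sum1_card big_mkcond [leqRHS]big_mkcond.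
apply: leq_sum => i' _; rewrite !inE in_L.
by case: (lidx I i' == j); rewrite ?andbF //; case: ifP.
Qed.

Lemma ev_removed m i (e : iexp) c : ready m -> iev m (var vI) i -> iev m e c ->
  bev m (removed e) (block_rank I i (lidx I i) < decode I c (lidx I i))%N.
Proof.
move=> [d wt rt] vi ve; have vl := ev_L d vi.
by apply: ev_lt; [exact: ev_rank|exact: ev_digit].
Qed.

Lemma wp_psi m k c : ready m -> iev m (var vK) k -> iev m (var vU) c -> (c < S)%N ->
  wp psi_prog (fun m' =>
    reals m' 3 0 = psi I k (greedy I k (decode I c)) /\
    ints m' vUsed 0 = state_code I (usage I k (greedy I k (decode I c)))) m.
Proof.
move=> rd vk vu cS; have wb := w_big; set u := decode I c; set x := greedy I k u.
have ul : forall j, (u j <= l I j)%N by exact: decode_le.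
have use_lt : (state_code I (usage I k x) < S)%N.
  by apply: usage_code_lt ul _; apply: greedy_action.
have lit0 m' : iev m' (ILit 0) 0%N by apply: iev_lit; exact: lit_ltw.
apply: wp_seq; apply: wp_rset; [exact: lit0|exact: rev_zero|].
apply: wp_seq; apply: wp_iset; [exact: lit0|exact: lit0|].
set m0 := iput _ _ _ _.
have rd0 : ready m0 by exact: rd.
have vk0 : ints m0 vK 0 = k by case: vk.
have vu0 : ints m0 vU 0 = c by case: vu.
pose val i := if (block_rank I i (lidx I i) < u (lidx I i))%N then 0
  else if (rank_excess i u < f I k)%N then beta I i else 0.
pose sumV p := \sum_(i < n | (i < p)%N) (if i \in F I k then val i else 0).
pose sumU p := (\sum_(i < n | (i < p)%N) (if i \in F I k then x i * weight I (lidx I i) else 0))%N.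
have sumUn : sumU n = state_code I (usage I k x).
  by rewrite /sumU big_ord_ltn -code_usage -big_mkcond.
apply: (wp_for (fun p m' => reals m' 3 0 = sumV p /\ ints m' vUsed 0 = sumU p) n) => //.
- by lia.
- by move=> m' km; case: (ready_keeps km _ _ rd0) => // d _ _; exact: ev_n.
- by split; rewrite /sumV /sumU big_ord_lt0.
- move=> p m1 pn k1 vp [inv1 inv2]; pose i := Ordinal pn.
  have rd1 : ready m1 by apply: ready_keeps k1 _ _ rd0.
  have [d1 wt1 rt1] := rd1.
  have vi : iev m1 (var vI) i by exact: ev_ord.
  have vk1 : iev m1 (var vK) k.
    by apply: iev_var; [rewrite (proj1 k1)|have := ltn_ord k; lia].
  have vu1 : iev m1 (var vU) c by apply: iev_var; [rewrite (proj1 k1)|lia].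
  have sumVS : sumV p.+1 = sumV p + if i \in F I k then val i else 0.
    by rewrite /sumV (big_ord_ltS _ _ i).
  have sumUS : sumU p.+1 = (sumU p + if i \in F I k then x i * weight I (lidx I i) else 0)%N.
    by rewrite /sumU (big_ord_ltS _ _ i).
  (* A partial sum is at most the full one, which is the code of a state and hence below S. *)
  have sumU_lt : (sumU p.+1 < w)%N.
    apply: leq_ltn_trans (_ : S < w)%N; last by lia.
    apply: leq_trans (ltnW use_lt); rewrite -sumUn /sumU big_ord_ltn big_mkcond.
    by apply: leq_sum => i' _; case: ifP.
  apply: wp_if (ev_eq (ev_F d1 vi) vk1) _ _ => [ik|nik]; last first.
    apply: wp_skip; rewrite sumVS sumUS in_F -val_eqE /= (negbTE nik) addr0 addn0.
    by split.
  have {}ik : i \in F I k by rewrite in_F -val_eqE.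
  rewrite sumUS ik in sumU_lt.
  apply: wp_if (ev_removed rd1 vi vu1) _ _ => rem.
    have xi : x i by rewrite ffunE ik.
    apply: wp_iset (lit0 _) _ _.
      rewrite xi mul1n in sumU_lt.
      apply: iev_add (ev_weight wt1 (ev_L d1 vi)) (sumU_lt).
      apply: iev_var inv2 _; apply: leq_ltn_trans sumU_lt; exact: leq_addr.
    by split; rewrite ?sumVS ?sumUS ik /= ?xi ?mul1n // /val rem addr0.
  have xi : x i = false by rewrite ffunE ik (negbTE rem).
  apply: wp_seq; apply: wp_iset (lit0 _) (lit0 _) _.
  set m2 := iput m1 _ _ _.
  have rd2 : ready m2 by exact: rd1.
  have vu2 : ints m2 vU 0 = c by case: vu1.
  have vk2 : ints m2 vK 0 = k by case: vk1.
  apply: wp_seq.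
  apply: (wp_for (fun q m' => ints m' vC 0 =
    \sum_(j < kl | (j < q)%N) (block_rank I i j - u j))%N kl) => //.
  + by lia.
  + by move=> m' km; case: (ready_keeps km _ _ rd2) => // d _ _; exact: ev_kl.
  + by rewrite big_ord_lt0.
  + move=> q m3 qkl k3 vq inv; pose j := Ordinal qkl.
    have [d3 wt3 rt3] : ready m3 by apply: ready_keeps k3 _ _ rd2.
    have vj3 : iev m3 (var vJ) j by apply: iev_var vq _; rewrite /=; lia.
    have vi3 : iev m3 (var vI) i by apply: ev_ord; rewrite (proj1 k3).
    have vu3 : iev m3 (var vU) c.
      by apply: iev_var; [rewrite (proj1 k3)|lia].
    have le_n := rank_excess_le i u.
    have sS := big_ord_ltS addn (fun j => block_rank I i j - u j)%N j.
    apply: wp_iset (lit0 _) _ _.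
      apply: iev_add; first by apply: iev_var inv _; have := le_n q; lia.
        by apply: iev_sub (ev_rank d3 rt3 vi3 vj3) (ev_digit d3 wt3 vu3 vj3).
      have le1 := le_n q.+1; rewrite sS in le1; apply: leq_ltn_trans le1 _; lia.
    by rewrite sS.
  move=> m3 k3; rewrite big_ord_ltn -/(rank_excess i u) => exE.
  have rd3 : ready m3 by apply: ready_keeps k3 _ _ rd2.
  have [d3 wt3 rt3] := rd3.
  have vi3 : iev m3 (var vI) i by apply: ev_ord; rewrite (proj1 k3).
  have vk3 : iev m3 (var vK) k.
    by apply: iev_var; [rewrite (proj1 k3)|have := ltn_ord k; lia].
  have p3 : reals m3 3 0 = sumV p by rewrite (proj2 k3).
  have u3 : ints m3 vUsed 0 = sumU p by rewrite (proj1 k3).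
  have vf : iev m3 (IGet 4 (var vK)) (f I k).
    by case: d3 => _ _ _ [_ df] _; apply: iev_get vk3 (df k) _; have := f_le k; lia.
  have vc : iev m3 (var vC) (rank_excess i u).
    apply: iev_var exE _; have := rank_excess_le i u kl.
    by rewrite big_ord_ltn -/(rank_excess i u); lia.
  apply: wp_if (ev_lt vc vf) _ _ => cmp.
    apply: wp_rset (lit0 _) _ _.
      apply: rev_add (rev_get (lit0 _) p3) (rev_get vi3 _).
      by case: d3 => _ _ _ _ ->.
    split; first by rewrite sumVS ik /val (negbTE rem) cmp.
    by rewrite sumUS ik xi mul0n addn0.
  apply: wp_skip; split; first by rewrite sumVS ik /val (negbTE rem) (negbTE cmp) addr0.
  by rewrite sumUS ik xi mul0n addn0.
move=> m' _ [-> ->]; rewrite sumUn; split=> //.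
by rewrite psi_greedy /sumV big_ord_ltn -big_mkcond.
Qed.

Definition choice_value (Vt : nat -> R) k r u :=
  psi I k (greedy I k u) +
  Vt (k.+1 * S + (state_code I r - state_code I (usage I k (greedy I k u))))%N.

(** State of the search after the counts of code below p: [v] is the best value so far and [c] a
    code attaining it. [Vt] is meant as the value array frozen before the stage; only row k + 1 of
    it is read while row k is written. *)
Definition best_below Vt k r p c v :=
  [/\ (c < p)%N, forall j, (decode I c j <= r j)%N,
      v = choice_value Vt k r (decode I c)
    & forall u, (forall j, u j <= r j)%N -> (state_code I u < p)%N ->
        v <= choice_value Vt k r u].

Section BestBelow.
Variables (Vt : nat -> R) (k : 'I_kf) (r : state) (p : nat).
Hypothesis rl : forall j, (r j <= l I j)%N.

Lemma code_ltS u : (forall j, u j <= r j)%N -> (state_code I u < p.+1)%N ->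
  (state_code I u < p)%N \/ u = decode I p.
Proof.
move=> ur; rewrite ltnS leq_eqVlt => /orP[/eqP<-|]; last by left.
by right; rewrite decode_code // => j; exact: leq_trans (ur j) (rl j).
Qed.

Lemma best_below_infeasible c v : ~~ [forall j, decode I p j <= r j]%N ->
  best_below Vt k r p c v -> best_below Vt k r p.+1 c v.
Proof.
move=> no [cp cr vE vle]; split=> //; first exact: ltnW.
move=> u ur /(code_ltS ur)[/(vle u ur)//|uE].
by case/negP: no; apply/forallP => j; rewrite -uE.
Qed.

Lemma best_below_keep c v : v <= choice_value Vt k r (decode I p) ->
  best_below Vt k r p c v -> best_below Vt k r p.+1 c v.
Proof.
move=> le [cp cr vE vle]; split=> //; first exact: ltnW.
by move=> u ur /(code_ltS ur)[/(vle u ur)//|->].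
Qed.

(** For p = 0 nothing is assumed of the old entries, which hold arbitrary data. *)
Lemma best_below_new : [forall j, decode I p j <= r j]%N ->
  (p = 0%N \/ exists c v, ~~ (v <= choice_value Vt k r (decode I p)) /\
     best_below Vt k r p c v) ->
  best_below Vt k r p.+1 p (choice_value Vt k r (decode I p)).
Proof.
move=> /forallP pr old; split=> // u ur /(code_ltS ur)[up|->//].
case: old => [p0|[c [v [nle [_ _ _ vle]]]]]; first by rewrite p0 in up.
by apply: le_trans (vle u ur up); rewrite ltW // ltNge.
Qed.

End BestBelow.

Definition other_rows k (Vt : nat -> R) m := forall k' c : nat, k' != k -> (c < S)%N ->
  reals m 2 (k' * S + c)%N = Vt (k' * S + c)%N.

Definition improved k Vt p r m :=
  best_below Vt k r p (ints m 9 (state_code I r)) (reals m 2 (k * S + state_code I r)%N).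

Lemma wp_improve m k Vt p : ready m -> iev m (var vK) k -> iev m (var vU) p -> (p < S)%N ->
  reals m 3 0 = psi I k (greedy I k (decode I p)) ->
  ints m vUsed 0 = state_code I (usage I k (greedy I k (decode I p))) ->
  other_rows k Vt m ->
  ((0 < p)%N -> forall r, (forall j, r j <= l I j)%N -> improved k Vt p r m) ->
  wp improve_prog (fun m' => other_rows k Vt m' /\
    forall r, (forall j, r j <= l I j)%N -> improved k Vt p.+1 r m') m.
Proof.
move=> rd vk vu pS psiE usedE rows old; have wb := w_big.
have lit0 m' : iev m' (ILit 0) 0%N by apply: iev_lit; exact: lit_ltw.
have lit1 m' : iev m' (ILit 1) 1%N by apply: iev_lit; exact: lit_ltw.
have kkf := ltn_ord k.
(* States of code below q have already been offered the counts p, the others not yet; for p = 0 the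
   latter carry no information. *)
apply: (wp_for (fun q m' => other_rows k Vt m' /\ forall r, (forall j, r j <= l I j)%N ->
   ((state_code I r < q)%N -> improved k Vt p.+1 r m') /\
   ((q <= state_code I r)%N -> (0 < p)%N -> improved k Vt p r m')) S) => //.
- by lia.
- by move=> m' km; case: (ready_keeps km _ _ rd) => // d wt _; exact: ev_S.
- by split=> // r rl; split=> // _ p0; exact: old.
- move=> q m1 qS k1 vq [rows1 inv1].
  have rd1 : ready m1 by apply: ready_keeps k1 _ _ rd.
  apply: wp_seq; apply: wp_iset (lit0 _) (lit1 _) _.
  set m2 := iput m1 _ _ _.
  have rd2 : ready m2 by exact: rd1.
  have vu2 : ints m2 vU 0 = p by case: vu => _ <-; rewrite /= -(proj1 k1).
  have vk2 : ints m2 vK 0 = k by case: vk => _ <-; rewrite /= -(proj1 k1).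
  have psi2 : reals m2 3 0 = psi I k (greedy I k (decode I p)) by rewrite -psiE -(proj2 k1).
  have used2 : ints m2 vUsed 0 = state_code I (usage I k (greedy I k (decode I p))).
    by rewrite -usedE -(proj1 k1).
  apply: wp_seq; apply: (wp_for (fun t m' => ints m' vC 0 =
    \big[andb/true]_(j < kl | (j < t)%N) (decode I p j <= decode I q j)%N) kl) => //.
  + by lia.
  + by move=> m' km; case: (ready_keeps km _ _ rd2) => // d _ _; exact: ev_kl.
  + by rewrite big_ord_lt0.
  + move=> t m3 tkl k3 vt inv; pose j := Ordinal tkl.
    have [d3 wt3 _] : ready m3 by apply: ready_keeps k3 _ _ rd2.
    have vj3 : iev m3 (var vJ) j by apply: iev_var vt _; rewrite /=; lia.
    have vu3 : iev m3 (var vU) p by apply: iev_var; [rewrite (proj1 k3)|lia].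
    have vr3 : iev m3 (var vR) q by apply: iev_var; [rewrite (proj1 k3)|lia].
    have sS := big_ord_ltS andb (fun j => decode I p j <= decode I q j)%N j.
    apply: wp_if (bev_lei (ev_digit d3 wt3 vu3 vj3) (ev_digit d3 wt3 vr3 vj3)) _ _ => le.
      by apply: wp_skip; rewrite sS /= le andbT.
    apply: wp_iset (lit0 _) (lit0 _) _.
    by rewrite sS /= (negbTE le) andbF.
  move=> m3 k3; rewrite big_ord_ltn big_andE => okE.
  have rd3 : ready m3 by apply: ready_keeps k3 _ _ rd2.
  have [d3 wt3 _] := rd3.
  have vu3 : iev m3 (var vU) p by apply: iev_var; [rewrite (proj1 k3)|lia].
  have vk3 : iev m3 (var vK) k by apply: iev_var; [rewrite (proj1 k3)|lia].
  have vr3 : iev m3 (var vR) q by apply: iev_var; [rewrite (proj1 k3)|lia].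
  have vok3 : iev m3 (var vC) [forall j, (decode I p j <= decode I q j)%N].
    by apply: iev_var okE _; case: [forall j, _]; exact: lit_ltw.
  have rows3 : other_rows k Vt m3 by move=> k' c kk' cS; rewrite (proj2 k3) //; exact: rows1.
  have inv3 r : (forall j, r j <= l I j)%N ->
      ((state_code I r < q)%N -> improved k Vt p.+1 r m3) /\
      ((q <= state_code I r)%N -> (0 < p)%N -> improved k Vt p r m3).
    by move=> /inv1; rewrite /improved (proj1 k3) // (proj2 k3).
  have codeq r : (forall j, r j <= l I j)%N -> state_code I r = q -> r = decode I q.
    by move=> rl <-; rewrite decode_code.
  (* A round affects only the entries of state q, so it remains to treat the state with that
     code. *)
  have finish m4 : (forall c, c != q -> ints m4 9 c = ints m3 9 c) ->
      other_rows k Vt m4 ->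
      (forall c, (c < S)%N -> c != q ->
        reals m4 2 (k * S + c)%N = reals m3 2 (k * S + c)%N) ->
      (forall r, (forall j, r j <= l I j)%N -> state_code I r = q -> improved k Vt p.+1 r m4) ->
      other_rows k Vt m4 /\ forall r, (forall j, r j <= l I j)%N ->
      ((state_code I r < q.+1)%N -> improved k Vt p.+1 r m4) /\
      ((q.+1 <= state_code I r)%N -> (0 < p)%N -> improved k Vt p r m4).
    move=> i4 r4 v4 new; split=> // r rl; have [lt ge] := inv3 r rl.
    have cS := code_lt rl.
    split=> [|qr p0].
      rewrite ltnS leq_eqVlt => /orP[/eqP/(new r rl)//|rq].
      by rewrite /improved i4 ?v4 ?ltn_eqF //; exact: lt.
    by rewrite /improved i4 ?v4 ?gtn_eqF //; exact: ge (ltnW qr) p0.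
  apply: wp_if (bev_lei (lit1 _) vok3) _ _ => ok.
    have {}ok : [forall j, (decode I p j <= decode I q j)%N] by case: [forall j, _] ok.
    have cS : (q - state_code I (usage I k (greedy I k (decode I p))) < S)%N.
      by apply: leq_ltn_trans qS; exact: leq_subr.
    have vk3' : iev m3 (incr (var vK)) k.+1 by apply: iev_incr vk3 _; lia.
    have vused3 : iev m3 (var vUsed) (state_code I (usage I k (greedy I k (decode I p)))).
      apply: iev_var; first by rewrite (proj1 k3).
      apply: leq_ltn_trans (_ : S < w)%N; last by lia.
      by apply/ltnW/(usage_code_lt (decode_le I p))/greedy_action.
    have cand3 : rev m3 candidate (psi I k (greedy I k (decode I p)) +
        Vt (k.+1 * S + (q - state_code I (usage I k (greedy I k (decode I p)))))%N).
      apply: rev_add; first by apply: rev_get (lit0 _) _; rewrite (proj2 k3).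
      have vnext := ev_row d3 wt3 vk3' (iev_sub vr3 vused3) kkf cS.
      apply: (rev_get vnext).
      by apply: rows3 => //; rewrite gtn_eqF.
    have vcell := ev_row d3 wt3 vk3 vr3 (ltnW kkf) qS.
    apply: wp_if (bev_and (bev_lei (lit1 _) vu3) (bev_ler (rev_get vcell erefl) cand3)) _ _.
      move=> /andP[p0 le]; apply: wp_skip; apply: (finish m3) => // r rl rq.
      apply: best_below_keep => //; first by rewrite /choice_value rq.
      by apply: (inv3 r rl).2; rewrite ?rq.
    move=> new; apply: wp_seq; apply: wp_rset vcell cand3 _.
    apply: (wp_iset (p := q) (x := p)); [exact: vr3|exact: vu3|].
    apply: finish.
    + by move=> c cq; rewrite /= update_other // update_elsewhere.
    + move=> k' c kk' cS'; rewrite /= update_elsewhere ?rows3 //.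
      by apply: contraNneq kk' => /(mulD_inj cS' qS)[->].
    + move=> c cS' cq; rewrite /= update_elsewhere //.
      by rewrite eqn_add2l.
    move=> r rl rq; rewrite /improved /= rq update_other // !update_same -rq.
    rewrite -/(choice_value Vt k r (decode I p)).
    apply: (best_below_new rl); first by rewrite (codeq r rl rq).
    case: (posnP p) => p0; [by left|right].
    exists (ints m3 9 q), (reals m3 2 (k * S + q)%N); split.
      by move: new; rewrite p0 /choice_value rq.
    by rewrite -rq; apply: (inv3 r rl).2; rewrite ?rq.
  have {}ok : ~~ [forall j, (decode I p j <= decode I q j)%N] by case: [forall j, _] ok.
  (* Code 0 decodes to the zero vector, feasible in every state. So infeasible counts have positive
     code, and the old entry is meaningful. *)
  have p0 : (0 < p)%N.
    rewrite lt0n; apply: contraNneq ok => ->; apply/forallP => j.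
    by rewrite decode0 ffunE.
  apply: wp_skip; apply: (finish m3) => // r rl rq.
  apply: best_below_infeasible => //; first by rewrite (codeq r rl rq).
  by apply: (inv3 r rl).2; rewrite ?rq.
- move=> m' _ [rows' inv']; split=> // r rl; apply: (inv' r rl).1.
  exact: code_lt.
Qed.

(** Stated for every p to allow induction on the digits; at p = kl, encoding undoes [decode] below
    S, the converse of [decode_code]. *)
Lemma low_code_decode c p : (p <= kl)%N -> low_code I (decode I c) p = (c %% weight I p)%N.
Proof.
elim: p => [|p IH] pkl; first by rewrite weight0 modn1 /low_code big_pred0.
set j := Ordinal pkl; have := IH (ltnW pkl).
rewrite -[p.+1]/(j.+1) low_codeS weightS => ->; rewrite ffunE /=.
set W := weight I p; set b := (l I j).+1; have W0 : (0 < W)%N by exact: weight_gt0.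
have lt1 : (c %% W < W)%N by rewrite ltn_mod.
have lt2 : (c %/ W %% b < b)%N by rewrite ltn_mod.
(* Two Euclidean divisions, by W and then by b, expose the remainder modulo W b. *)
have cE : c = (c %/ W %/ b * (W * b) + (c %% W + c %/ W %% b * W))%N.
  rewrite {1}(divn_eq c W) {1}(divn_eq (c %/ W) b) mulnDl -mulnA -addnA.
  by rewrite [(b * W)%N]mulnC [(_ * W + c %% W)%N]addnC.
rewrite [in RHS]cE modnMDl [in RHS]modn_small //.
rewrite [(W * b)%N]mulnC; apply: (@leq_trans ((c %/ W %% b).+1 * W)).
  by rewrite mulSn ltn_add2r.
by rewrite leq_mul2r lt2 orbT.
Qed.

Lemma code_decode c : (c < S)%N -> state_code I (decode I c) = c.
Proof. by move=> cS; rewrite -low_code_kl low_code_decode // modn_small ?weight_kl. Qed.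

(** All stages share array 6, cell (c, i) belonging to the stage of item i. Cells outside F_k must
    keep the bits of the stages already treated. *)
Lemma wp_store m k : ready m -> iev m (var vK) k ->
  (forall c, (c < S)%N -> ints m 9 c < S)%N ->
  wp store_prog (fun m' => forall c i, (c < S)%N -> ints m' 6 (c * n + i)%N =
    if i \in F I k then greedy I k (decode I (ints m 9 c)) i : nat
    else ints m 6 (c * n + i)%N) m.
Proof.
move=> rd vk bS; have wb := w_big; have kkf := ltn_ord k.
have lit b : (b <= 1)%N -> forall m', iev m' (ILit b) b.
  by move=> b1 m'; apply: iev_lit; apply: lit_ltw; lia.
pose cell (done : nat -> 'I_n -> bool) m' := forall c i, (c < S)%N ->
  ints m' 6 (c * n + i)%N =
    if (i \in F I k) && done c i then greedy I k (decode I (ints m 9 c)) i : nat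
    else ints m 6 (c * n + i)%N.
apply: (wp_for (fun p => cell (fun c i => c < p)%N) S) => //.
- by lia.
- by move=> m' km; case: (ready_keeps km _ _ rd) => // d wt _; exact: ev_S.
- by move=> c i cS; rewrite ltn0 andbF.
- move=> p m1 pS k1 vp inv.
  have rd1 : ready m1 by apply: ready_keeps k1 _ _ rd.
  apply: (wp_for (fun q => cell (fun c i => (c < p) || (c == p) && (i < q)))%N n) => //.
  + by lia.
  + by move=> m' km; case: (ready_keeps km _ _ rd1) => // d _ _; exact: ev_n.
  + by move=> c i cS; rewrite ltn0 andbF orbF; exact: inv.
  + move=> q m2 qn k2 vq inv2; pose i := Ordinal qn.
    have rd2 : ready m2 by apply: ready_keeps k2 _ _ rd1.
    have [d2 wt2 rt2] := rd2.
    have vi2 : iev m2 (var vI) i by apply: ev_ord.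
    have vk2 : iev m2 (var vK) k.
      apply: iev_var; [rewrite (proj1 k2) // (proj1 k1) //|lia].
      by case: vk.
    have vr2 : iev m2 (var vR) p by apply: iev_var; [rewrite (proj1 k2)|lia].
    have vb2 : iev m2 (IGet 9 (var vR)) (ints m 9 p).
      by apply: iev_get vr2 _ _; [rewrite (proj1 k2) // (proj1 k1)|have := bS _ pS; lia].
    have vcell := ev_cell d2 vr2 vi2 pS.
    have skip m3 : (forall c i', (c < S)%N -> (c, i') != (p, i) ->
          ints m3 6 (c * n + i')%N = ints m2 6 (c * n + i')%N) ->
        ints m3 6 (p * n + i)%N = (if i \in F I k then
          greedy I k (decode I (ints m 9 p)) i : nat else ints m2 6 (p * n + i)%N) ->
        cell (fun c i => (c < p) || (c == p) && (i < q.+1))%N m3.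
      move=> other this c i' cS; have [[-> ->]|ne] := eqVneq (c, i') (p, i).
        rewrite this eqxx ltnS leqnn orbT andbT; have [//|nik] := boolP (i \in F I k).
        by rewrite inv2 // (negbTE nik).
      rewrite other // inv2 //; congr (if _ && _ then _ else _).
      have [ep|//] := eqVneq c p; rewrite ltnS [(i' <= q)%N]leq_eqVlt.
      have /negbTE-> // : i' != q :> nat.
      by apply: contraNneq ne => ei; apply/eqP; congr pair => //; exact: val_inj.
    have put b : greedy I k (decode I (ints m 9 p)) i = b :> nat -> i \in F I k ->
        cell (fun c i => (c < p) || (c == p) && (i < q.+1))%N
          (iput (iput m2 6 (p * n + i)%N b) vI 0 q.+1).
      move=> gb ik; apply: skip => [c i' cS ne|] /=; rewrite update_other //.
        rewrite update_elsewhere //; apply: contraNneq ne.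
        by move=> /(mulD_inj (ltn_ord i') (ltn_ord i))[-> /val_inj->].
      by rewrite update_same ik gb.
    apply: wp_if (ev_eq (ev_F d2 vi2) vk2) _ _ => [ik|nik]; last first.
      apply: wp_skip; apply: skip => // /=.
      by rewrite in_F -val_eqE (negbTE nik).
    have {}ik : i \in F I k by rewrite in_F -val_eqE.
    apply: wp_if (ev_removed rd2 vi2 vb2) _ _ => rem.
      apply: (wp_iset vcell (lit 1%N isT _)).
      by apply: put => //; rewrite ffunE ik rem.
    apply: (wp_iset vcell (lit 0%N isT _)).
    by apply: put => //; rewrite ffunE ik (negbTE rem).
  move=> m2 k2 inv2 c i cS; rewrite /= update_other // inv2 //.
  by rewrite ltn_ord andbT [(c < p.+1)%N]ltnS [(c <= p)%N]leq_eqVlt orbC.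
- by move=> m' _ inv c i cS; rewrite inv // cS andbT.
Qed.

(** Refers to the current memory only, so it can be carried through later rounds. Minimality is over
    counts; the exchange argument extends it to all actions. *)
Definition stage_done k m := forall r, (forall j, r j <= l I j)%N -> exists u,
  [/\ forall j, (u j <= r j)%N,
      reals m 2 (k * S + state_code I r)%N = choice_value (reals m 2) k r u,
      forall u', (forall j, u' j <= r j)%N ->
        reals m 2 (k * S + state_code I r)%N <= choice_value (reals m 2) k r u'
    & forall i, i \in F I k -> ints m 6 (state_code I r * n + i)%N = greedy I k u i].

(** Only row k + 1 is read, so writes to other rows leave the candidates of stage k unchanged. *)
Lemma choice_value_ext k r u Vt Vt' : (forall j, r j <= l I j)%N ->
  (forall c, (c < S)%N -> Vt (k.+1 * S + c)%N = Vt' (k.+1 * S + c)%N) ->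
  choice_value Vt k r u = choice_value Vt' k r u.
Proof.
move=> rl VV'; congr (_ + _); apply: VV'.
by apply: leq_ltn_trans (code_lt rl); exact: leq_subr.
Qed.

Lemma wp_stage m k : ready m -> ints m vT 0 = (kf - k.+1)%N ->
  wp stage_prog (fun m' => [/\ other_rows k (reals m 2) m', stage_done k m' &
    forall c i, (c < S)%N -> i \notin F I k ->
      ints m' 6 (c * n + i)%N = ints m 6 (c * n + i)%N]) m.
Proof.
move=> rd vt; have wb := w_big; have kkf := ltn_ord k.
have [d wt _] := rd.
apply: wp_seq; apply: (wp_iset (p := 0%N) (x := k)).
- by apply: iev_lit; exact: lit_ltw.
- have -> : nat_of_ord k = (kf - (kf - k.+1).+1)%N by lia.
  by apply: iev_sub (ev_kf d) _; apply: iev_incr; [apply: iev_var vt _|]; lia.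
set m0 := iput _ _ _ _; have rd0 : ready m0 by exact: rd.
set Vt := reals m 2.
apply: wp_seq; apply: (wp_for (fun p m' => other_rows k Vt m' /\ ((0 < p)%N ->
  forall r, (forall j, r j <= l I j)%N -> improved k Vt p r m')) S) => //.
- by lia.
- by move=> m' km; case: (ready_keeps km _ _ rd0) => // d' wt' _; exact: ev_S.
- move=> p m1 pS k1 vp [rows1 inv1].
  have rd1 : ready m1 by apply: ready_keeps k1 _ _ rd0.
  have vk1 : iev m1 (var vK) k by apply: iev_var; [rewrite (proj1 k1)|lia].
  have vu1 : iev m1 (var vU) p by apply: iev_var vp _; lia.
  apply: wp_seq; apply: wp_conseq (wp_psi rd1 vk1 vu1 pS) _ => m2 k2 [psi2 used2].
  have rd2 : ready m2 by apply: ready_keeps k2 _ _ rd1.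
  have vk2 : iev m2 (var vK) k by apply: iev_var; [rewrite (proj1 k2) // (proj1 k1)|lia].
  have vu2 : iev m2 (var vU) p by apply: iev_var; [rewrite (proj1 k2)|lia].
  have [||] := wp_improve (Vt := Vt) rd2 vk2 vu2 pS psi2 used2.
  + by move=> k' c kk' cS; rewrite (proj2 k2) //; exact: rows1.
  + by move=> p0 r rl; rewrite /improved (proj1 k2) // (proj2 k2) //; exact: inv1.
  by move=> m3 [t [ex le [rows3 inv3]]]; exists m3, t; split.
(* By [S_gt0] at least the counts 0 have been tried, so the tables no longer hold arbitrary data. *)
move=> m1 k1 [rows1 /(_ S_gt0) inv1].
have rd1 : ready m1 by apply: ready_keeps k1 _ _ rd0.
have vk1 : iev m1 (var vK) k by apply: iev_var; [rewrite (proj1 k1)|lia].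
have bS c : (c < S)%N -> (ints m1 9 c < S)%N.
  by move=> cS; case: (inv1 _ (decode_le I c)); rewrite code_decode.
apply: wp_conseq (wp_store rd1 vk1 bS) _ => m2 k2 cells.
have rows2 : other_rows k Vt m2 by move=> k' c kk' cS; rewrite (proj2 k2) //; exact: rows1.
split=> // [r rl|c i cS nik]; last by rewrite cells // (negbTE nik) (proj1 k1).
have [cS cr vE vle] := inv1 r rl.
have ext u : choice_value (reals m2 2) k r u = choice_value Vt k r u.
  by apply: choice_value_ext rl _ => c cS'; apply: rows2 => //; rewrite gtn_eqF.
exists (decode I (ints m1 9 (state_code I r))); split=> //.
- by rewrite ext (proj2 k2).
- move=> u ur; rewrite ext (proj2 k2) //; apply: vle => //.
  by apply: leq_ltn_trans (code_mono I ur) (code_lt rl).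
- by move=> i ik; rewrite cells ?ik ?code_lt.
Qed.

Lemma wp_backward m : ready m ->
  wp backward_prog (fun m' =>
    (forall c, (c < S)%N -> reals m' 2 (kf * S + c)%N = 0) /\
    forall k, stage_done k m') m.
Proof.
move=> rd; have wb := w_big.
apply: wp_seq; apply: (wp_for (fun p m' => forall c, (c < p)%N ->
  reals m' 2 (kf * S + c)%N = 0) S) => //.
- by lia.
- by move=> m' km; case: (ready_keeps km _ _ rd) => // d wt _; exact: ev_S.
- move=> p m1 pS k1 vp inv.
  have [d1 wt1 _] : ready m1 by apply: ready_keeps k1 _ _ rd.
  have vr1 : iev m1 (var vR) p by apply: iev_var vp _; lia.
  apply: (wp_rset (ev_row d1 wt1 (ev_kf d1) vr1 (leqnn _) pS) (rev_zero _ _)).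
  move=> c; rewrite ltnS leq_eqVlt => /orP[/eqP->|cp] /=; first exact: update_same.
  by rewrite update_elsewhere ?inv // eqn_add2l ltn_eqF.
move=> m1 k1 zero; have rd1 : ready m1 by apply: ready_keeps k1 _ _ rd.
apply: (wp_for (fun p m' => (forall c, (c < S)%N -> reals m' 2 (kf * S + c)%N = 0) /\
  forall k, (kf - p <= k)%N -> stage_done k m') kf) => //.
- by lia.
- by move=> m' km; case: (ready_keeps km _ _ rd1) => // d _ _; exact: ev_kf.
- by split=> // k; rewrite subn0 leqNgt ltn_ord.
- move=> p m2 pkf k2 vp [zero2 done2].
  have rd2 : ready m2 by apply: ready_keeps k2 _ _ rd1.
  have lt : (kf - p.+1 < kf)%N by lia.
  have vt : ints m2 vT 0 = (kf - (Ordinal lt).+1)%N by rewrite vp /=; lia.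
  apply: wp_conseq (wp_stage rd2 vt) _ => m3 k3 [rows3 done3 cells3].
  split=> [c cS|k]; first by rewrite rows3 ?zero2 //=; lia.
  have [-> _|ne] := eqVneq k (Ordinal lt); first exact: done3.
  move: ne; rewrite -val_eqE /= => ne le.
  have gt : (kf - p <= k)%N by lia.
  move=> r rl; have [u [ur vE vle cE]] := done2 k gt r rl.
  (* Stage k comes after the current one, so neither row k nor row k + 1 has been touched. *)
  have ext u' : choice_value (reals m3 2) k r u' = choice_value (reals m2 2) k r u'.
    by apply: choice_value_ext rl _ => c cS; apply: rows3 => //=; lia.
  have vE3 : reals m3 2 (k * S + state_code I r)%N = reals m2 2 (k * S + state_code I r)%N.
    by apply: rows3; rewrite ?code_lt.
  exists u; split=> // [|u' u'r|i ik]; rewrite /= ?vE3 ?ext //; first exact: vle.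
  rewrite update_other // cells3 ?cE ?code_lt //.
  by move: ik; rewrite !in_F => /eqP->; rewrite -val_eqE.
- by move=> m2 _ [zero2 done2]; split=> // k; apply: done2; rewrite subnn.
Qed.

(** The mask removes the bits of other stages, which lie in the same row of array 6. *)
Definition stored m k r : bvec n :=
  [ffun i => (i \in F I k) && (ints m 6 (state_code I r * n + i)%N == 1%N)].

Lemma stored_greedy m k r u :
  (forall i, i \in F I k -> ints m 6 (state_code I r * n + i)%N = greedy I k u i) ->
  stored m k r = greedy I k u.
Proof.
move=> cE; apply/ffunP => i; rewrite ffunE; have [ik|ik] := boolP (i \in F I k).
  by rewrite cE //; case: (greedy _ _ _ _).
by rewrite ffunE (negbTE ik).
Qed.

Lemma stored_cell m k r i : stage_done k m -> (forall j, r j <= l I j)%N ->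
  i \in F I k -> ints m 6 (state_code I r * n + i)%N = stored m k r i.
Proof. by move=> dn rl ik; have [u [_ _ _ cE]] := dn r rl; rewrite (stored_greedy cE) cE. Qed.

Lemma stored_action m k r : stage_done k m -> (forall j, r j <= l I j)%N ->
  stage_action I k r (stored m k r).
Proof.
move=> dn rl; have [u [ur _ _ cE]] := dn r rl; rewrite (stored_greedy cE).
exact: greedy_action.
Qed.

(** * Residual budgets along the forward pass *)

Fixpoint residual m p : state :=
  if p is q.+1 then
    oapp (fun k => theta I k (residual m q) (stored m k (residual m q)))
      (residual m q) (insub q)
  else full_budget I.

Lemma residualS m k :
  residual m k.+1 = theta I k (residual m k) (stored m k (residual m k)).
Proof. by rewrite /= valK. Qed.

Lemma residual_le m p j : (residual m p j <= l I j)%N.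
Proof.
elim: p => [|p IH] /=; first by rewrite ffunE.
case: (insub p) => //= k; rewrite ffunE; apply: leq_trans IH; exact: leq_subr.
Qed.

(** All digits are maximal: adding one carries through and gives the next weight. *)
Lemma code_full : state_code I (full_budget I) = (S - 1)%N.
Proof.
rewrite -low_code_kl -weight_kl.
suff full p : (p <= kl)%N -> (low_code I (full_budget I) p).+1 = weight I p.
  by rewrite -full // subn1.
elim: p => [|p IH] pkl; first by rewrite weight0 /low_code big_pred0.
set j := Ordinal pkl; rewrite -[p.+1]/(j.+1) low_codeS weightS ffunE -(IH (ltnW pkl)) /=.
by rewrite [RHS]mulnS addSn mulnC.
Qed.

(** [residual] is indexed by all naturals so that the invariant can name the state reached after the
    last stage. *)
Lemma wp_forward m : ready m -> (forall k, stage_done k m) ->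
  wp forward_prog (fun m' =>
    (forall i, ints m' 5 i = stored m (fidx I i) (residual m (fidx I i)) i) /\
    reals m' 1 0 = reals m 2 (state_code I (full_budget I))) m.
Proof.
move=> rd dn; have wb := w_big; have [d wt _] := rd.
have lit b : (b <= 1)%N -> forall m', iev m' (ILit b) b.
  by move=> b1 m'; apply: iev_lit; apply: lit_ltw; lia.
have lit0 := lit 0%N isT; have lit1 := lit 1%N isT.
pose bit i := stored m (fidx I i) (residual m (fidx I i)) i.
have code_ltw p : (state_code I (residual m p) < S)%N by apply/code_lt/residual_le.
apply: wp_seq; apply: (wp_iset (lit0 _) (iev_sub (ev_S d wt) (lit1 _))).
set m0 := iput _ _ _ _; have rd0 : ready m0 by exact: rd.
apply: wp_seq; apply: (wp_for (fun p m' => ints m' vS 0 = state_code I (residual m p) /\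
  forall i, (fidx I i < p)%N -> ints m' 5 i = bit i) kf) => //.
- by lia.
- by move=> m' km; case: (ready_keeps km _ _ rd0) => // d' _ _; exact: ev_kf.
- by split=> //; rewrite code_full.
- move=> p m1 pkf k1 vp [code1 bits1]; pose k := Ordinal pkf.
  have rd1 : ready m1 by apply: ready_keeps k1 _ _ rd0.
  have vs1 : iev m1 (var vS) (state_code I (residual m p)).
    by apply: iev_var code1 _; have := code_ltw p; lia.
  set r := residual m p in code1 vs1.
  have rl : forall j, (r j <= l I j)%N by exact: residual_le.
  apply: wp_seq; apply: (wp_iset (lit0 _) vs1); set m2 := iput m1 _ _ _.
  have rd2 : ready m2 by exact: rd1.
  have code2 : ints m2 vS 0 = state_code I r by exact: code1.
  have vk2 : ints m2 vK 0 = p by exact: vp.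
  pose used q := (\sum_(i < n | (i < q)%N)
    (if i \in F I k then stored m k r i * weight I (lidx I i) else 0))%N.
  apply: wp_seq; apply: (wp_for (fun q m' =>
    ints m' vS' 0 = (state_code I r - used q)%N /\
    forall i, (fidx I i < p)%N || (fidx I i == k) && (i < q)%N -> ints m' 5 i = bit i) n) => //.
  + by lia.
  + by move=> m' km; case: (ready_keeps km _ _ rd2) => // d' _ _; exact: ev_n.
  + split; first by rewrite /used big_ord_lt0 subn0.
    by move=> i; rewrite andbF orbF => /bits1.
  + move=> q m3 qn k3 vq [code3 bits3]; pose i := Ordinal qn.
    have rd3 : ready m3 by apply: ready_keeps k3 _ _ rd2.
    have [d3 wt3 _] := rd3.
    have vi3 : iev m3 (var vI) i by apply: ev_ord.
    have vk3 : iev m3 (var vK) k by apply: iev_var; [rewrite (proj1 k3)|rewrite /=; lia].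
    have usedS : used q.+1 =
        (used q + if i \in F I k then stored m k r i * weight I (lidx I i) else 0)%N.
      by rewrite /used (big_ord_ltS _ _ i).
    apply: wp_if (ev_eq (ev_F d3 vi3) vk3) _ _ => [ik|nik]; last first.
      apply: wp_skip; split; first by rewrite usedS in_F -val_eqE (negbTE nik) addn0.
      move=> i' /= h; rewrite update_other //; apply: bits3; move: h.
      case: ltnP => //= _ /andP[ik' i'q]; rewrite ik' /=.
      move: i'q; rewrite ltnS leq_eqVlt => /orP[/eqP i'q|//].
      by case/negP: nik; rewrite (_ : i = i') ?(eqP ik') //; exact: val_inj.
    have {}ik : i \in F I k by rewrite in_F -val_eqE.
    have vs3 : iev m3 (var vS) (state_code I r).
      by apply: iev_var; [rewrite (proj1 k3)|have := code_ltw p; rewrite -/r; lia].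
    have cell m' : ints m' 6 (state_code I r * n + i)%N = ints m 6 (state_code I r * n + i)%N ->
        iev m' (iadd (imul (var vS) num_items) (var vI)) (state_code I r * n + i)%N ->
        iev m' stored_bit (stored m k r i).
      move=> same ev; apply: iev_get ev _ _; last by case: (stored _ _ _ _); apply: lit_ltw.
      by rewrite same (stored_cell (dn k)).
    have same3 : ints m3 6 (state_code I r * n + i)%N = ints m 6 (state_code I r * n + i)%N.
      transitivity (ints m1 6 (state_code I r * n + i)%N); first exact: (proj1 k3).
      exact: (proj1 k1).
    have vcell := ev_cell d3 vs3 vi3 (code_ltw p).
    have bitE : stored m k r i = bit i.
      by rewrite /bit; move: ik; rewrite in_F => /eqP->.
    apply: wp_seq; apply: (wp_iset vi3 (cell _ same3 vcell)).
    set m4 := iput m3 _ _ _.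
    have rd4 : ready m4 by exact: rd3.
    have [d4 wt4 _] := rd4.
    have vi4 : iev m4 (var vI) i by exact: vi3.
    have vs4 : iev m4 (var vS') (state_code I r - used q)%N.
      by apply: iev_var code3 _; have := code_ltw p; rewrite -/r; lia.
    apply: (wp_iset (lit0 _)).
      apply: iev_sub vs4 _; apply: iev_mul (cell m4 same3 vcell) (ev_weight wt4 (ev_L d4 vi4)) _.
      have := weight_ltw (ltnW (ltn_ord (lidx I i))).
      by case: (stored _ _ _ _); rewrite ?mul1n ?mul0n //; lia.
    (* Successive truncated subtractions amount to subtracting the total, so feasibility enters only
       once, through [code_theta]. *)
    split; first by rewrite usedS ik subnDA.
    move=> i' /= h; rewrite update_other // update_other //.
    have [->|ne] := eqVneq i' i; first by rewrite update_same bitE.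
    have {}ne : i' != q :> nat by apply: contraNneq ne => e; exact/eqP/val_inj.
    rewrite update_elsewhere //.
    apply: bits3; move: h; case: ltnP => //= _ /andP[-> i'q] /=.
    by rewrite ltn_neqAle ne -ltnS.
  move=> m3 k3 [code3 bits3].
  have vs3 : iev m3 (var vS') (state_code I (residual m p.+1)).
    apply: iev_var; last by have := code_ltw p.+1; lia.
    rewrite code3 -[p.+1]/(k.+1) residualS code_theta; last exact: stored_action.
    by rewrite -code_usage /used big_ord_ltn [in RHS]big_mkcond.
  apply: (wp_iset (lit0 _) vs3); split=> // i ip /=.
  rewrite !update_other // bits3 // ltn_ord andbT.
  by move: ip; rewrite ltnS leq_eqVlt orbC -val_eqE.
move=> m1 k1 [_ bits].
have rd1 : ready m1 by apply: ready_keeps k1 _ _ rd0.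
have [d1 wt1 _] := rd1.
apply: (wp_rset (lit0 _) (rev_get (iev_sub (ev_S d1 wt1) (lit1 _)) erefl)).
split=> [i|]; first by apply: bits; exact: ltn_ord.
by rewrite /= update_same (proj2 k1) // code_full.
Qed.

(** * From memory contents to a run of the algorithm *)

Definition table m k r : R := reals m 2 (k * S + state_code I r)%N.

(** An arbitrary action is compared with the greedy one for its counts: same next state by
    [usage_greedy_usage], no larger [psi] by [psi_greedy_le]. The zero row covers the last stage. *)
Lemma backward_pass_stored m : (forall c, (c < S)%N -> reals m 2 (kf * S + c)%N = 0) ->
  (forall k, stage_done k m) -> backward_pass I (table m) (stored m).
Proof.
move=> zero dn k r /stage_state_le rl.
have costE x : stage_action I k r x -> cost_to_go I (table m) k r x =
    psi I k x + reals m 2 (k.+1 * S + (state_code I r - state_code I (usage I k x)))%N.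
  move=> xr; rewrite /cost_to_go; congr (_ + _); rewrite -code_theta //.
  have [[k' kk' ->]|[kE ->]] /= := next_stage k; first by rewrite /table kk'.
  rewrite -kE zero //; apply: code_lt => j; rewrite ffunE; apply: leq_trans (rl j).
  exact: leq_subr.
have act := stored_action (dn k) rl; split=> // [|x xr].
  rewrite costE //; have [u [ur vE _ /stored_greedy->]] := dn k r rl.
  exact: vE.
rewrite costE //; have [_ [_ _ vle _]] := dn k r rl.
have ur j : (usage I k x j <= r j)%N by case: xr => _ /(_ j); rewrite ffunE.
apply: le_trans (vle _ ur) _; rewrite /choice_value usage_greedy_usage lerD2r.
exact: psi_greedy_le.
Qed.

Lemma forward_pass_residual m x : (forall i, x i = stored m (fidx I i) (residual m (fidx I i)) i) ->
  forward_pass I (stored m) (fun k => residual m k) x.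
Proof.
move=> xE; split=> [k ->//|k k' ->|k i]; first exact: residualS.
by rewrite in_F xE => /eqP->.
Qed.

Lemma wp_dp m : (0 < n)%N -> data m ->
  wp dp_prog (fun m' => exists V xt x v, output_memory I V xt x v m' /\ dp_run I V xt x v) m.
Proof.
move=> n0 d.
apply: wp_seq; apply: wp_conseq (wp_weights d) _ => m1 k1 wt1.
have d1 : data m1 by apply: data_keeps k1 _ _ d.
apply: wp_seq; apply: wp_conseq (wp_ranks d1) _ => m2 k2 rt2.
have rd2 : ready m2.
  by split=> //; [apply: data_keeps k2 _ _ d1|apply: weight_table_keeps k2 _ wt1].
apply: wp_seq; apply: wp_conseq (wp_backward rd2) _ => m3 k3 [zero dn].
have rd3 : ready m3 by apply: ready_keeps k3 _ _ rd2.
apply: wp_conseq (wp_forward rd3 dn) _ => m4 k4 [bits val].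
pose x : bvec n := [ffun i => stored m3 (fidx I i) (residual m3 (fidx I i)) i].
exists (table m3), (stored m3), x, (reals m4 1 0%N); split; first split=> //.
- by move=> i; rewrite bits [x i]ffunE.
- by move=> k r _; rewrite (proj2 k4).
- by move=> k r i /stage_state_le rl ik; rewrite (proj1 k4) // (stored_cell (dn k)).
split; first exact: backward_pass_stored.
  by exists (fun k => residual m3 k); apply: forward_pass_residual => i; rewrite [LHS]ffunE.
(* Some item exists and lies in some F_k, so there is a stage 0. *)
have kf0 : (0 < kf)%N by case: (fidx I (Ordinal n0)) => k; exact: leq_ltn_trans.
by exists (Ordinal kf0).
Qed.

End Verification.

(** * Running time *)

Section RunningTime.
Variable kl : nat.
Implicit Types (c : cmd) (e d : nat).

Definition sizes n kf S := [/\ (0 < n)%N, (kf <= n)%N & (S <= 2 ^ kl * n ^ kl)%N].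

(** The constant depends on kl and the command only, so loops over the kl leader blocks do not raise
    the exponent. *)
Definition time_O c e := exists C, forall n kf S, sizes n kf S ->
  (time (loop_bound n kl kf S) c <= C * n ^ e)%N.

Lemma time_O_weaken e c e' : (e <= e')%N -> time_O c e -> time_O c e'.
Proof.
move=> ee' [C CO]; exists C => n kf S sz; apply: leq_trans (CO n kf S sz) _.
by rewrite leq_mul2l leq_pexp2l ?orbT //; case: sz.
Qed.

Lemma time_O_skip : time_O Skip 0.
Proof. by exists 1%N => n kf S _; rewrite expn0. Qed.

Lemma time_O_iset a (e1 e2 : iexp) : time_O (ISet a e1 e2) 0.
Proof. by exists (icost e1 + icost e2).+1 => n kf S _; rewrite expn0 muln1. Qed.

Lemma time_O_rset a (e1 : iexp) (e2 : rexp) : time_O (RSet a e1 e2) 0.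
Proof. by exists (icost e1 + rcost e2).+1 => n kf S _; rewrite expn0 muln1. Qed.

Lemma time_O_seq c1 c2 e : time_O c1 e -> time_O c2 e -> time_O (Seq c1 c2) e.
Proof.
move=> [C1 O1] [C2 O2]; exists (C1 + C2)%N => n kf S sz /=.
by rewrite mulnDl leq_add ?O1 ?O2.
Qed.

Lemma time_O_if b c1 c2 e : time_O c1 e -> time_O c2 e -> time_O (If b c1 c2) e.
Proof.
move=> [C1 O1] [C2 O2]; exists ((bcost b).+1 + (C1 + C2))%N => n kf S sz /=.
rewrite -addSn mulnDl leq_add //; last by rewrite mulnDl leq_add ?O1 ?O2.
by rewrite leq_pmulr // expn_gt0; case: sz => ->.
Qed.

Lemma time_O_for v (e : iexp) body d :
  (exists D, forall n kf S, sizes n kf S ->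
     (loop_bound n kl kf S (BLeI (incr (var v)) e) <= D * n ^ d)%N) ->
  forall e', time_O body e' -> time_O (For v e body) (d + e').
Proof.
move=> [D DO] e' [C CO]; set g := BLeI (incr (var v)) e.
(* 3 is the cost of setting the loop variable; 7 is 6 for incrementing it plus 1 for the loop step;
   [D.+1] includes the failing test. *)
exists (3 + D.+1 * (bcost g + C + 7))%N => n kf S sz.
have n0 : (0 < n)%N by case: sz.
have ge1 x : (1 <= n ^ x)%N by rewrite expn_gt0 n0.
have := DO _ _ _ sz; have := CO _ _ _ sz; have := ge1 d; have := ge1 e'.
rewrite expnD -[time _ (For _ _ _)]/(3 + (loop_bound n kl kf S g).+1 *
  (bcost g + (time (loop_bound n kl kf S) body + 6)).+1)%N.
move: (n ^ d)%N (n ^ e')%N (loop_bound _ _ _ _ _) (time _ _) (bcost g) => X Y N T b.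
move=> Y1 X1 TY NX; rewrite mulnDl; apply: leq_add; first by nia.
rewrite -mulnACA; apply: leq_mul; rewrite ?mulSn ?mulnDl; nia.
Qed.

Lemma bound_n v : exists D, forall n kf S, sizes n kf S ->
  (loop_bound n kl kf S (BLeI (incr (var v)) num_items) <= D * n ^ 1)%N.
Proof. by exists 1%N => n kf S _; rewrite mul1n expn1. Qed.

Lemma bound_kl v : exists D, forall n kf S, sizes n kf S ->
  (loop_bound n kl kf S (BLeI (incr (var v)) num_L) <= D * n ^ 0)%N.
Proof. by exists kl => n kf S _; rewrite expn0 muln1. Qed.

Lemma bound_kf v : exists D, forall n kf S, sizes n kf S ->
  (loop_bound n kl kf S (BLeI (incr (var v)) num_F) <= D * n ^ 1)%N.
Proof. by exists 1%N => n kf S [_ ? _]; rewrite mul1n expn1. Qed.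

Lemma bound_S v : exists D, forall n kf S, sizes n kf S ->
  (loop_bound n kl kf S (BLeI (incr (var v)) num_states) <= D * n ^ kl)%N.
Proof. by exists (2 ^ kl)%N => n kf S []. Qed.

Lemma time_dp : (0 < kl)%N -> time_O dp_prog (2 * kl + 1).
Proof.
move=> kl0.
have leaf c : time_O c 0 -> forall e, time_O c e.
  by move=> tc e; exact: time_O_weaken tc.
have skip := leaf _ time_O_skip.
have iset a (e1 e2 : iexp) := leaf _ (time_O_iset a e1 e2).
have rset a (e1 : iexp) (e2 : rexp) := leaf _ (time_O_rset a e1 e2).
have loop_kl v body e : time_O body e -> time_O (For v num_L body) e.
  exact: time_O_for (bound_kl v) _.
have loop_n v body e : time_O body e -> time_O (For v num_items body) e.+1.
  exact: time_O_for (bound_n v) _.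
have loop_kf v body e : time_O body e -> time_O (For v num_F body) e.+1.
  exact: time_O_for (bound_kf v) _.
have loop_S v body e : time_O body e -> time_O (For v num_states body) (kl + e).
  exact: time_O_for (bound_S v) _.
have weights : time_O weights_prog 0 by apply: time_O_seq => //; apply: loop_kl.
have ranks : time_O ranks_prog 2.
  apply/loop_n/time_O_seq; first exact: loop_kl.
  by apply/loop_n/time_O_if.
have psi : time_O psi_prog 1.
  do 2!apply: time_O_seq => //; apply/loop_n/time_O_if => //; apply: time_O_if => //.
  apply: time_O_seq => //; apply: time_O_seq; first exact: loop_kl.
  exact: time_O_if.
have improve : time_O improve_prog (kl + 0).
  apply: loop_S; apply: time_O_seq => //; apply: time_O_seq.
    by apply/loop_kl/time_O_if.
  by apply: time_O_if => //; apply: time_O_if => //; apply: time_O_seq.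
have store : time_O store_prog (kl + 1).
  by apply/loop_S/loop_n/time_O_if => //; apply: time_O_if.
have stage : time_O stage_prog (kl + kl).
  apply: time_O_seq => //; apply: time_O_seq.
    (* Here kl >= 1 enters: the O(n) evaluation of [psi] for each u is absorbed by the n^kl bound on
       the inner loop over states. *)
    apply/loop_S/time_O_seq; first exact: time_O_weaken psi.
    by apply: time_O_weaken improve; rewrite addn0.
  by apply: time_O_weaken store; rewrite leq_add2l.
have backward : time_O backward_prog (2 * kl + 1).
  apply: time_O_seq.
    by apply: time_O_weaken (loop_S _ _ 0%N _) => //; lia.
  by apply: time_O_weaken (loop_kf _ _ _ stage); lia.
have forward : time_O forward_prog 2.
  apply: time_O_seq => //; apply: time_O_seq => //; apply: loop_kf.
  do 2!apply: time_O_seq => //; apply/loop_n/time_O_if => //; exact: time_O_seq.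
apply: time_O_seq; first exact: time_O_weaken weights.
apply: time_O_seq; first by apply: time_O_weaken ranks; lia.
by apply: time_O_seq => //; apply: time_O_weaken forward; lia.
Qed.

End RunningTime.

(** * Size of the state space and existence of runs *)

Section Runs.
Context {R : realType} {n kl kf : nat} (I : instance R n kl kf).

Lemma input_data (m : memory R) : input_memory I m -> data I m.
Proof.
move=> [dn dL dF dlf db]; split=> // i.
  by apply: dL; rewrite in_L.
by apply: dF; rewrite in_F.
Qed.

(** From l_j + 1 <= n + 1 <= 2 n; this is the origin of the factor 2^kl. *)
Lemma state_count_le : (0 < n)%N -> (state_count I <= 2 ^ kl * n ^ kl)%N.
Proof.
move=> n0; rewrite -expnMn -[X in (_ ^ X)%N](card_ord kl) -prod_nat_const.
apply: leq_prod => j _; have : (l I j <= n)%N.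
  by apply: leq_trans (l_sum I); rewrite (bigD1 j) //= leq_addr.
lia.
Qed.

Definition encoding : memory R := Memory
  (fun a p => match a with
     | 0 => nth 0 [:: n; kl; kf] p
     | 1 => oapp (fun i : 'I_n => lidx I i : nat) 0 (insub p)
     | 2 => oapp (fun i : 'I_n => fidx I i : nat) 0 (insub p)
     | 3 => oapp (l I) 0 (insub p)
     | 4 => oapp (f I) 0 (insub p)
     | _ => 0
     end%N)
  (fun _ p => oapp (beta I) 0 (insub p)).

(** Instead of building the tables by recursion, the verified program is run on a memory encoding
    the instance, with [w] equal to the bound in [w_big]. *)
Lemma dp_run_exists : (0 < n)%N -> exists V xt x v, dp_run I V xt x v.
Proof.
move=> n0.
have d : data I encoding.
  by split=> [|i|i||i]; rewrite /= ?valK //; split=> ? /=; rewrite valK.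
have [m [t [_ _ [V [xt [x [v [_ run]]]]]]]] := wp_dp (leqnn _) n0 d.
by exists V, xt, x, v.
Qed.

End Runs.

Local Close Scope ring_scope.

Theorem theorem3 (R : realType) :
  (forall (n kl kf : nat) (I : instance R n kl kf), 0 < n ->
     (exists V xt x v, dp_run I V xt x v) /\
     (forall V xt x v, dp_run I V xt x v ->
        optimal_solution I x /\ v = optimal_value I)) /\
  (exists P : cmd, forall kl : nat, exists C : nat,
     forall (n kf : nat) (I : instance R n kl kf), 0 < n -> kf <= n ->
     forall m0 : memory R, input_memory I m0 ->
     exists V xt x v m1 t,
       [/\ exec (C * n ^ (kl + 1)) P m0 m1 t,
           t <= C * n ^ (2 * kl + 1),
           output_memory I V xt x v m1
         & dp_run I V xt x v]).
Proof.
split=> [n kl kf I n0|].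
  by split; [exact: dp_run_exists|exact: dp_run_correct].
exists dp_prog => kl; have [kl0|kl0] := posnP kl.
  (* With kl = 0 no leader block could contain an item, so no instance has n > 0 and any constant
     serves. *)
  exists 0%N => n kf I n0.
  by have := ltn_ord (lidx I (Ordinal n0)); rewrite [X in (_ < X)%N]kl0 ltn0.
have [C timeC] := time_dp kl0.
(* C bounds the time. In units of n^(kl + 1), the terms (kf + 1) S, S n and S of [w_big] take 2 + 1
   + 1 times 2^kl, n kl and kl take 2 kl, and n, kf and 4 take 6. *)
exists (C + (4 * 2 ^ kl + 2 * kl + 6))%N => n kf I n0 kfn m0 /input_data d.
have S_le := state_count_le I n0.
have [|m1 [t [ex le [V [xt [x [v [out run]]]]]]]] :=
  @wp_dp R n kl kf I ((C + (4 * 2 ^ kl + 2 * kl + 6)) * n ^ (kl + 1)) _ m0 n0 d.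
  have : (0 < n ^ kl)%N by rewrite expn_gt0 n0.
  move: S_le; rewrite expnD expn1.
  move: (state_count I) (2 ^ kl)%N (n ^ kl)%N => S D A SDA A0.
  have nA : (n <= A * n)%N by nia.
  have SA : (S * n <= D * (A * n))%N by nia.
  have kS : (kf.+1 * S <= 2 * D * (A * n))%N by nia.
  nia.
exists V, xt, x, v, m1, t; split=> //.
apply: leq_trans le _; apply: leq_trans (timeC _ _ _ _) _ => //.
by rewrite leq_mul2r leq_addr orbT.
Qed.
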